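(* Let $a,b\in\mathbb{R}$. Suppose that the rotation number $r(S_{ab})$ is irrational and that the $S_{ab}$-orbit of $(0,1)$ contains $(0,-1)$. Then: (1) the $T_{ab}$-orbit of $(0,1)$ contains $(0,-1)$; (2) the closure of every nonzero orbit $\{T_{ab}^{(j)}(\mathbf{w}) : j\in\mathbb{Z}\}$, $\mathbf{w}\neq 0$, is an invariant circle of $T_{ab}$ which is a finite union of arcs of conic sections; moreover the conic arcs occurring in such an invariant circle are all of the same type: either all arcs of ellipses, or all arcs of hyperbolas, or all straight line segments.
   Context: For real parameters $a,b$, the map $T_{ab}:\mathbb{R}^2\to\mathbb{R}^2$ is $T_{ab}(x,y)=(ax-y,x)$ if $x\ge 0$ and $T_{ab}(x,y)=(bx-y,x)$ if $x<0$. It is an area-preserving homeomorphism of the plane, satisfies $T_{ab}(\lambda\mathbf{w})=\lambda T_{ab}(\mathbf{w})$ for $\lambda>0$, and maps rays from the origin onto rays from the origin. $T_{ab}^{(j)}$ denotes the $j$-th iterate of $T_{ab}$ for $j\in\mathbb{Z}$ (negative $j$ meaning iterates of $T_{ab}^{-1}$). The induced map $S_{ab}:S^1\to S^1$, $S_{ab}(\mathbf{u})=T_{ab}(\mathbf{u})/|T_{ab}(\mathbf{u})|$, is an orientation-preserving homeomorphism of the unit circle; $r(S_{ab})$ denotes its Poincaré rotation number, measured counterclockwise in units of full turns. An invariant circle of $T_{ab}$ is a simple closed curve in $\mathbb{R}^2\setminus\{0\}$ meeting every open ray from the origin in exactly one point and satisfying $T_{ab}(\mathcal{C})=\mathcal{C}$.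 *)

(* Defs.v *)
From Stdlib Require Import Reals ZArith.
Open Scope R_scope.

Definition pt := (R * R)%type.

Definition T (a b : R) (w : pt) : pt :=
  let (x, y) := w in
  if Rle_dec 0 x then (a * x - y, x) else (b * x - y, x).

Definition pnorm (w : pt) : R := sqrt (fst w * fst w + snd w * snd w).

Definition S (a b : R) (u : pt) : pt :=
  let v := T a b u in (fst v / pnorm v, snd v / pnorm v).

(** Orbit (over j in Z) of w under a homeomorphism f: z = f^j(w) for some j >= 0,
    or f^j(z) = w for some j >= 0 (i.e. z = f^(-j)(w)). *)
Definition orbit (f : pt -> pt) (w : pt) (z : pt) : Prop :=
  exists n : nat, z = Nat.iter n f w \/ Nat.iter n f z = w.

Definition e (t : R) : pt := (cos (2 * PI * t), sin (2 * PI * t)).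

(** rho is a (real representative of the) Poincare rotation number of the circle
    map g: rho = lim F^n(0)/n for a continuous lift F of g. *)
Definition rotation_number (g : pt -> pt) (rho : R) : Prop :=
  exists F : R -> R,
    continuity F /\
    (forall t, F (t + 1) = F t + 1) /\
    (forall t, g (e t) = e (F t)) /\
    Un_cv (fun n => Nat.iter n F 0 / INR n) rho.

Definition irrational (x : R) : Prop :=
  ~ exists p q : Z, q <> 0%Z /\ x = IZR p / IZR q.

Definition closure (A : pt -> Prop) (p : pt) : Prop :=
  forall eps, 0 < eps -> exists q, A q /\
    pnorm (fst p - fst q, snd p - snd q) < eps.

Definition pcont (g : R -> pt) : Prop :=
  continuity (fun t => fst (g t)) /\ continuity (fun t => snd (g t)).

Definition simple_closed_curve (C : pt -> Prop) : Prop :=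
  exists g : R -> pt, pcont g /\ (forall t, g (t + 1) = g t) /\
    (forall s t, 0 <= s < 1 -> 0 <= t < 1 -> g s = g t -> s = t) /\
    (forall p, C p <-> exists t, 0 <= t <= 1 /\ p = g t).

Definition scal (l : R) (u : pt) : pt := (l * fst u, l * snd u).

Definition invariant_circle (a b : R) (C : pt -> Prop) : Prop :=
  simple_closed_curve C /\
  (forall p, C p -> p <> (0, 0)) /\
  (forall u : pt, u <> (0, 0) ->
     exists p, (C p /\ exists l, 0 < l /\ p = scal l u) /\
       forall q, (C q /\ exists l, 0 < l /\ q = scal l u) -> q = p) /\
  (forall p, C p -> C (T a b p)) /\
  (forall q, C q -> exists p, C p /\ T a b p = q).

Record conic := mkConic { cA : R; cB : R; cC : R; cD : R; cE : R; cF : R }.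

Definition conic_eval (k : conic) (p : pt) : R :=
  let (x, y) := p in
  cA k * x * x + cB k * x * y + cC k * y * y + cD k * x + cE k * y + cF k.

(** Determinant of the 3x3 symmetric matrix of the conic (nondegeneracy). *)
Definition conic_det (k : conic) : R :=
  let A := cA k in let B := cB k / 2 in let C := cC k in
  let D := cD k / 2 in let E := cE k / 2 in let F := cF k in
  A * (C * F - E * E) - B * (B * F - E * D) + D * (B * E - C * D).

Inductive conic_type := Ellipse | Hyperbola | Line.

Definition has_type (k : conic) (ty : conic_type) : Prop :=
  match ty with
  | Ellipse => cB k * cB k - 4 * cA k * cC k < 0 /\ conic_det k <> 0
  | Hyperbola => cB k * cB k - 4 * cA k * cC k > 0 /\ conic_det k <> 0
  | Line => cA k = 0 /\ cB k = 0 /\ cC k = 0 /\ (cD k <> 0 \/ cE k <> 0)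
  end.

Definition arc_of (g : R -> pt) (p : pt) : Prop := exists t, 0 <= t <= 1 /\ p = g t.

Definition is_arc (g : R -> pt) : Prop :=
  pcont g /\ (forall s t, 0 <= s <= 1 -> 0 <= t <= 1 -> g s = g t -> s = t).

Definition conic_arc (ty : conic_type) (g : R -> pt) : Prop :=
  is_arc g /\ exists k, has_type k ty /\ forall p, arc_of g p -> conic_eval k p = 0.

(* Main.v *)
Require Import Defs.
From Stdlib Require Import Reals ZArith List.
From Stdlib Require Import Lra Lia Classical.
Open Scope R_scope.

(** [T] is linear except along the two vertical rays, where its derivative
    jumps by opposite shears.  If [T^n] carries one ray to the other, a
    piecewise linear map [H] broken along the images of the first ray can
    absorb both jumps, so that [H T H^-1] is linear.  The price is that [H]
    lives on the universal cover of the punctured plane and has a monodromy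
    [M] along a full turn; [M] commutes with the linear map [L = H T H^-1].
    Two commuting matrices of determinant 1 preserve a common nonzero
    quadratic form, whose pullback by [H] is a [T]-invariant piecewise
    quadratic function [Q] on the plane.  The zero directions of [Q] are
    finitely many and permuted by [S]; as an irrational rotation number
    excludes periodic directions, [Q] has no zero and its level curves are
    the invariant circles.  All the quadratic pieces of [Q] have the same
    discriminant, hence the common conic type.  Orbits are dense in the level
    curves because the determinant of two vectors of [Q = 1], computed after
    applying [H], is invariant and prevents wandering intervals. *)

(** * Intervals and pigeonholes *)

(** A jump of [H] across a ray is a shear along it, and replacing [v] by [l v] multiplies the
    coefficient of a shear by [l^2]. Pushed forward by [T], a jump is thus multiplied by the square
    of the stretch along its ray. Linearity of [H T H^-1] becomes the equation [K (F t) = (K t -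
    slope_jump t) * rho t ^ 2] for the jump sizes [K]. It is solved by a jump that is born from the
    break of [T] at one pole, travels along the orbit and is absorbed at the other pole. It arrives
    there multiplied by the squared norm of [T^n (0, s)], and the opposite break absorbs it only if
    this norm is [1]. This is why the first claim, about points and not just directions, comes
    before the second. Nothing forces the jumps met along a full turn to compose to the identity, so
    [H] is a function of the real angle and not of the direction. *)

Lemma interval_chaining (P : R -> R -> Prop) :
  (forall x y z, x <= y -> y <= z -> P x y -> P y z -> P x z) ->
  (forall t, exists d, 0 < d /\
     forall x y, t - d < x <= t -> t <= y < t + d -> P x y) ->
  forall x y, x <= y -> P x y.
Proof.
  intros Ht Hl x y Hxy.
  (* Compactness of the segment, through the supremum of the right ends reachable from [x]. This one
     induction principle later gives local constancy, finiteness of zeros, uniform estimates and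
     finite covers by arcs. *)
  pose (E := fun z => x <= z <= y /\ P x z).
  assert (Pxx : P x x).
  { destruct (Hl x) as [d [Hd H]]. apply H; lra. }
  destruct (completeness E) as [s [Hs1 Hs2]].
  - exists y. intros z [Hz _]. lra.
  - exists x. split; [lra | exact Pxx].
  - assert (Hxs : x <= s) by (apply Hs1; split; [lra | exact Pxx]).
    assert (Hsy : s <= y) by (apply Hs2; intros z [Hz _]; lra).
    destruct (Hl s) as [d [Hd H]].
    assert (Hz : exists z, E z /\ s - d < z).
    { apply NNPP; intro N.
      assert (s <= s - d); [| lra].
      apply Hs2; intros z Ez. apply Rnot_lt_le; intro L.
      apply N; exists z; split; assumption. }
    destruct Hz as [z [[Hz1 Hz2] Hz3]].
    assert (Hzs : z <= s) by (apply Hs1; split; assumption).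
    assert (Hreach : forall v, s <= v < s + d -> P x v).
    { intros v Hv. apply Ht with z; try lra; [assumption | apply H; lra]. }
    destruct (Rle_lt_or_eq_dec s y Hsy) as [Hlt | Heq].
    + assert (Em : E (Rmin y (s + d / 2))).
      { split.
        - unfold Rmin; destruct Rle_dec; lra.
        - apply Hreach. unfold Rmin; destruct Rle_dec; lra. }
      apply Hs1 in Em. unfold Rmin in Em; destruct Rle_dec; lra.
    + subst y. apply Hreach. lra.
Qed.

Lemma locally_constant_eq (X : Type) (f : R -> X) :
  (forall t, exists d, 0 < d /\ forall s, t - d < s < t + d -> f s = f t) ->
  forall s t, f s = f t.
Proof.
  intros H.
  assert (Hle : forall s t, s <= t -> f s = f t).
  { apply interval_chaining.
    - intros x y z _ _ -> ->; reflexivity.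
    - intros t. destruct (H t) as [d [Hd Hc]]. exists d. split; [assumption |].
      intros x y Hx Hy. rewrite (Hc x), (Hc y) by lra. reflexivity. }
  intros s t. destruct (Rle_lt_dec s t) as [h | h].
  - apply Hle; assumption.
  - symmetry; apply Hle; lra.
Qed.

Lemma pigeonhole (A : Type) (f : nat -> A) (l : list A) :
  (forall n, In (f n) l) -> exists i j, (i < j)%nat /\ f i = f j.
Proof.
  intros H. apply NNPP; intro N.
  assert (ND : NoDup (map f (seq 0 (Datatypes.S (length l))))).
  { apply NoDup_map_NoDup_ForallPairs; [| apply seq_NoDup].
    intros i j _ _ E.
    destruct (Nat.lt_trichotomy i j) as [h | [h | h]]; [| assumption |].
    - exfalso; apply N; exists i, j; auto.
    - exfalso; apply N; exists j, i; auto. }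
  assert (I : incl (map f (seq 0 (Datatypes.S (length l)))) l).
  { intros a Ha. apply in_map_iff in Ha. destruct Ha as [n [<- _]]. apply H. }
  pose proof (NoDup_incl_length ND I) as L.
  rewrite length_map, length_seq in L. lia.
Qed.

Lemma floor_exists (r : R) : exists m : Z, IZR m <= r < IZR m + 1.
Proof.
  exists (Int_part r). destruct (base_Int_part r). lra.
Qed.

Lemma IZR_unit_eq (m n : Z) (r : R) :
  IZR m <= r < IZR m + 1 -> IZR n <= r < IZR n + 1 -> m = n.
Proof.
  intros [H1 H2] [H3 H4].
  assert (IZR m < IZR (n + 1)) by (rewrite plus_IZR; lra).
  assert (IZR n < IZR (m + 1)) by (rewrite plus_IZR; lra).
  apply lt_IZR in H, H0. lia.
Qed.

Lemma pigeonhole_close (f : nat -> R) (eps : R) :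
  0 < eps -> exists i j, (i < j)%nat /\ exists m : Z, Rabs (f j - f i + IZR m) < eps.
Proof.
  intros He.
  destruct (archimed (/ eps)) as [HN _]. set (N := up (/ eps)) in HN.
  assert (HN0 : 0 < IZR N) by (apply Rlt_trans with (/ eps); [apply Rinv_0_lt_compat |]; assumption).
  assert (HNe : / IZR N < eps).
  { rewrite <- (Rinv_inv eps). apply Rinv_lt_contravar; [| assumption].
    apply Rmult_lt_0_compat; [apply Rinv_0_lt_compat |]; assumption. }
  (* Fractional parts are sorted into [N] boxes of length below [eps]; [c n] is the box number. *)
  pose (c := fun n => (Int_part (IZR N * (f n - IZR (Int_part (f n)))))).
  destruct (pigeonhole Z c (map Z.of_nat (seq 0 (Z.to_nat N)))) as [i [j [Hij E]]].
  - intros n. unfold c.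
    set (x := f n - IZR (Int_part (f n))).
    assert (Hx : 0 <= x < 1) by (unfold x; destruct (base_Int_part (f n)); lra).
    destruct (base_Int_part (IZR N * x)) as [B1 B2].
    set (k := Int_part (IZR N * x)) in *.
    assert (K1 : -1 < IZR k) by nra.
    assert (K2 : IZR k < IZR N) by nra.
    apply lt_IZR in K1, K2.
    apply in_map_iff. exists (Z.to_nat k). split; [lia |].
    apply in_seq. lia.
  - exists i, j. split; [assumption |].
    exists (Int_part (f i) - Int_part (f j))%Z.
    unfold c in E.
    destruct (base_Int_part (IZR N * (f i - IZR (Int_part (f i))))) as [A1 A2].
    destruct (base_Int_part (IZR N * (f j - IZR (Int_part (f j))))) as [B1 B2].
    rewrite E in A1, A2.
    set (k := Int_part (IZR N * (f j - IZR (Int_part (f j))))) in *.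
    rewrite minus_IZR.
    set (x := f i - IZR (Int_part (f i))) in *.
    set (y := f j - IZR (Int_part (f j))) in *.
    replace (f j - f i + (IZR (Int_part (f i)) - IZR (Int_part (f j)))) with (y - x)
      by (unfold x, y; ring).
    apply Rlt_trans with (/ IZR N); [| assumption].
    assert (Hc : IZR N * / IZR N = 1) by (apply Rinv_r; lra).
    apply Rabs_def1; apply Rmult_lt_reg_l with (IZR N); try assumption; lra.
Qed.

(** * Plane linear algebra *)

Record mat := Mat { m11 : R; m12 : R; m21 : R; m22 : R }.

Definition mapp (m : mat) (p : pt) : pt :=
  (m11 m * fst p + m12 m * snd p, m21 m * fst p + m22 m * snd p).

Definition mmul (m n : mat) : mat :=
  Mat (m11 m * m11 n + m12 m * m21 n) (m11 m * m12 n + m12 m * m22 n)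
      (m21 m * m11 n + m22 m * m21 n) (m21 m * m12 n + m22 m * m22 n).

Definition mid : mat := Mat 1 0 0 1.

Definition mdet (m : mat) : R := m11 m * m22 m - m12 m * m21 m.

Definition madj (m : mat) : mat := Mat (m22 m) (- m12 m) (- m21 m) (m11 m).

Definition cross (p q : pt) : R := fst p * snd q - snd p * fst q.

(** The map [p |-> p + k * cross v p * v]. It is quadratic in [v], so [v] and [- v] give the same
    shear. *)
Definition shear (v : pt) (k : R) : mat :=
  Mat (1 - k * fst v * snd v) (k * fst v * fst v)
      (- k * snd v * snd v) (1 + k * fst v * snd v).

Ltac mat_eq :=
  unfold mmul, mapp, mid, madj, shear, scal, cross; simpl;
  try (f_equal; ring).

Lemma mapp_mmul m n p : mapp (mmul m n) p = mapp m (mapp n p).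
Proof. mat_eq. Qed.

Lemma mmul_assoc m n p : mmul m (mmul n p) = mmul (mmul m n) p.
Proof. mat_eq. Qed.

Lemma mmul_1_l m : mmul mid m = m.
Proof. destruct m; mat_eq. Qed.

Lemma mmul_1_r m : mmul m mid = m.
Proof. destruct m; mat_eq. Qed.

Lemma mapp_scal m l p : mapp m (scal l p) = scal l (mapp m p).
Proof. mat_eq. Qed.

Lemma mdet_mmul m n : mdet (mmul m n) = mdet m * mdet n.
Proof. unfold mdet; simpl; ring. Qed.

Lemma mdet_madj m : mdet (madj m) = mdet m.
Proof. unfold mdet; simpl; ring. Qed.

Lemma mmul_madj_l m : mdet m = 1 -> mmul (madj m) m = mid.
Proof. unfold mdet; intros H; mat_eq. unfold mid; f_equal; ring [H] || lra. Qed.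

Lemma mmul_madj_r m : mdet m = 1 -> mmul m (madj m) = mid.
Proof. unfold mdet; intros H; mat_eq. unfold mid; f_equal; ring [H] || lra. Qed.

Lemma madj_mmul m n : madj (mmul m n) = mmul (madj n) (madj m).
Proof. mat_eq. Qed.

Lemma cross_mapp m p q : cross (mapp m p) (mapp m q) = mdet m * cross p q.
Proof. unfold cross, mapp, mdet; simpl; ring. Qed.

Lemma mdet_shear v k : mdet (shear v k) = 1.
Proof. unfold mdet, shear; simpl; ring. Qed.

Lemma shear_self v k : mapp (shear v k) v = v.
Proof. destruct v; mat_eq. Qed.

Lemma shear_0 v : shear v 0 = mid.
Proof. mat_eq. Qed.

Lemma madj_shear v k : madj (shear v k) = shear v (- k).
Proof. mat_eq. Qed.

Lemma shear_add v k l : mmul (shear v k) (shear v l) = shear v (k + l).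
Proof. mat_eq. Qed.

Lemma shear_scal l v k : shear (scal l v) k = shear v (k * l * l).
Proof. mat_eq. Qed.

(** A matrix of determinant 1 preserves [cross], so conjugation moves the axis of a shear and keeps
    its coefficient. *)
Lemma mmul_shear m v k :
  mdet m = 1 -> mmul m (shear v k) = mmul (shear (mapp m v) k) m.
Proof.
  intros H. destruct m as [p q r s], v as [x y].
  assert (E : p * s = 1 + q * r) by (unfold mdet in H; simpl in H; lra).
  unfold mmul, mapp, shear; simpl. f_equal; ring [E].
Qed.

(** * Binary quadratic forms *)

Record form := Form { fA : R; fB : R; fC : R }.

Definition quad (k : form) (p : pt) : R :=
  fA k * fst p * fst p + fB k * fst p * snd p + fC k * snd p * snd p.

Definition fdisc (k : form) : R := fB k * fB k - 4 * fA k * fC k.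

Definition fnonzero (k : form) : Prop := ~ (fA k = 0 /\ fB k = 0 /\ fC k = 0).

Definition fopp (k : form) : form := Form (- fA k) (- fB k) (- fC k).

Definition pullback (k : form) (m : mat) : form :=
  Form (quad k (m11 m, m21 m))
       (2 * fA k * m11 m * m12 m + fB k * (m11 m * m22 m + m12 m * m21 m)
        + 2 * fC k * m21 m * m22 m)
       (quad k (m12 m, m22 m)).

Lemma quad_pullback k m p : quad (pullback k m) p = quad k (mapp m p).
Proof. unfold quad, pullback, mapp, quad; simpl; ring. Qed.

Lemma fdisc_pullback k m : fdisc (pullback k m) = fdisc k * (mdet m * mdet m).
Proof. unfold fdisc, pullback, mdet, quad; simpl; ring. Qed.

Lemma pullback_mmul k m n : pullback (pullback k m) n = pullback k (mmul m n).
Proof. unfold pullback, mmul, quad; simpl; f_equal; ring. Qed.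

Lemma pullback_mid k : pullback k mid = k.
Proof. destruct k; unfold pullback, mid, quad; simpl; f_equal; ring. Qed.

Lemma pullback_nonzero k m : mdet m = 1 -> fnonzero k -> fnonzero (pullback k m).
Proof.
  intros D N [H1 [H2 H3]]. apply N.
  rewrite <- (pullback_mid k), <- (mmul_madj_r m D), <- pullback_mmul.
  destruct (pullback k m) as [x y z]; simpl in *; subst.
  unfold quad; simpl; repeat split; ring.
Qed.

Lemma quad_scal k l p : quad k (scal l p) = l * l * quad k p.
Proof. unfold quad, scal; simpl; ring. Qed.

Lemma quad_fopp k p : quad (fopp k) p = - quad k p.
Proof. unfold quad, fopp; simpl; ring. Qed.

Lemma fopp_nonzero k : fnonzero k -> fnonzero (fopp k).
Proof. intros N [H1 [H2 H3]]; apply N; simpl in *; repeat split; lra. Qed.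

Lemma quad_three_zeros k p q r :
  cross p q <> 0 -> cross p r <> 0 -> cross q r <> 0 ->
  quad k p = 0 -> quad k q = 0 -> quad k r = 0 -> ~ fnonzero k.
Proof.
  destruct k as [A B C], p as [x1 y1], q as [x2 y2], r as [x3 y3].
  unfold cross, quad; simpl. intros D1 D2 D3 Q1 Q2 Q3 N.
  set (d1 := x1 * y2 - y1 * x2) in *.
  set (d2 := x1 * y3 - y1 * x3) in *.
  set (d3 := x2 * y3 - y2 * x3) in *.
  assert (D : d1 * d2 * d3 <> 0) by (repeat apply Rmult_integral_contrapositive_currified; assumption).
  set (q1 := A * x1 * x1 + B * x1 * y1 + C * y1 * y1) in *.
  set (q2 := A * x2 * x2 + B * x2 * y2 + C * y2 * y2) in *.
  set (q3 := A * x3 * x3 + B * x3 * y3 + C * y3 * y3) in *.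
  (* Cramer's rule for the coefficients in terms of the three values: [d1 * d2 * d3] is the
     homogeneous Vandermonde determinant of the system. *)
  assert (HA : A * (d1 * d2 * d3) = q1 * (y2 * y3 * d3) - q2 * (y1 * y3 * d2) + q3 * (y1 * y2 * d1))
    by (unfold q1, q2, q3, d1, d2, d3; ring).
  assert (HB : B * (d1 * d2 * d3) = - q1 * ((x2 * y3 + y2 * x3) * d3)
     + q2 * ((x1 * y3 + y1 * x3) * d2) - q3 * ((x1 * y2 + y1 * x2) * d1))
    by (unfold q1, q2, q3, d1, d2, d3; ring).
  assert (HC : C * (d1 * d2 * d3) = q1 * (x2 * x3 * d3) - q2 * (x1 * x3 * d2) + q3 * (x1 * x2 * d1))
    by (unfold q1, q2, q3, d1, d2, d3; ring).
  rewrite Q1, Q2, Q3 in HA, HB, HC.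
  apply N; simpl; repeat split.
  - destruct (Rmult_integral A (d1 * d2 * d3)); [lra | assumption | tauto].
  - destruct (Rmult_integral B (d1 * d2 * d3)); [lra | assumption | tauto].
  - destruct (Rmult_integral C (d1 * d2 * d3)); [lra | assumption | tauto].
Qed.

Definition self_form (m : mat) : form := Form (m21 m) (m22 m - m11 m) (- m12 m).

Lemma quad_self_form m p : quad (self_form m) p = cross p (mapp m p).
Proof. unfold quad, self_form, cross, mapp; simpl; ring. Qed.

Lemma self_form_invariant m n p :
  mdet n = 1 -> mmul m n = mmul n m ->
  quad (self_form m) (mapp n p) = quad (self_form m) p.
Proof.
  intros D E. rewrite !quad_self_form, <- mapp_mmul, E, mapp_mmul, cross_mapp, D. ring.
Qed.

(** If every vector is an eigenvector, the matrix is scalar; determinant 1 leaves the identity and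
    its opposite, under which quadratic forms are even. *)
Lemma scalar_of_self_form_zero m :
  ~ fnonzero (self_form m) -> mdet m = 1 ->
  forall k p, quad k (mapp m p) = quad k p.
Proof.
  intros N D k p. apply NNPP in N. destruct N as [N1 [N2 N3]].
  destruct m as [x y z w], p as [s t]; unfold mdet in D; simpl in *.
  assert (y = 0) by lra. assert (w = x) by lra. subst.
  assert (E : x * x = 1) by lra.
  unfold quad, mapp; simpl. ring [E].
Qed.

(* For a nonscalar [M], the form [p |-> cross p (M p)] is invariant under
   everything of determinant 1 that commutes with [M]. *)
Lemma common_invariant_form L M :
  mdet L = 1 -> mdet M = 1 -> mmul L M = mmul M L ->
  exists k, fnonzero k /\ (forall p, quad k (mapp L p) = quad k p) /\
            (forall p, quad k (mapp M p) = quad k p).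
Proof.
  intros DL DM C.
  destruct (classic (fnonzero (self_form M))) as [NM | NM].
  { exists (self_form M). split; [assumption |].
    split; intros p; apply self_form_invariant; auto. }
  destruct (classic (fnonzero (self_form L))) as [NL | NL].
  { exists (self_form L). split; [assumption |].
    split; intros p; apply self_form_invariant; auto. }
  exists (Form 1 0 1). split; [intros [H _]; simpl in H; lra |].
  split; intros p; apply scalar_of_self_form_zero; assumption.
Qed.

(** * The circle and the map [T] *)

Lemma pt_eq (p q : pt) : fst p = fst q -> snd p = snd q -> p = q.
Proof. destruct p, q; simpl; intros -> ->; reflexivity. Qed.

Lemma scal_scal l m p : scal l (scal m p) = scal (l * m) p.
Proof. unfold scal; simpl; f_equal; ring. Qed.

Lemma scal_1 p : scal 1 p = p.
Proof. destruct p; unfold scal; simpl; f_equal; ring. Qed.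

Lemma pnorm_pos p : p <> (0, 0) -> 0 < pnorm p.
Proof.
  destruct p as [x y]; intros N; unfold pnorm; simpl. apply sqrt_lt_R0.
  destruct (Req_dec x 0) as [-> | Hx]; [destruct (Req_dec y 0) as [-> | Hy] |].
  - tauto.
  - nra.
  - nra.
Qed.

Lemma pnorm_scal l p : 0 <= l -> pnorm (scal l p) = l * pnorm p.
Proof.
  intros Hl. unfold pnorm, scal; simpl.
  replace (l * fst p * (l * fst p) + l * snd p * (l * snd p))
    with ((l * l) * (fst p * fst p + snd p * snd p)) by ring.
  rewrite sqrt_mult_alt by nra. rewrite sqrt_square by assumption. reflexivity.
Qed.

Lemma e_sqr t : fst (e t) * fst (e t) + snd (e t) * snd (e t) = 1.
Proof. unfold e; simpl. pose proof (sin2_cos2 (2 * PI * t)). unfold Rsqr in *; lra. Qed.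

Lemma pnorm_e t : pnorm (e t) = 1.
Proof. unfold pnorm. rewrite e_sqr. apply sqrt_1. Qed.

Lemma e_neq_0 t : e t <> (0, 0).
Proof. intros H. pose proof (e_sqr t) as E. rewrite H in E; simpl in E; lra. Qed.

Lemma e_shift t : e (t + 1) = e t.
Proof.
  unfold e. replace (2 * PI * (t + 1)) with (2 * PI * t + 2 * PI) by ring.
  rewrite cos_plus, sin_plus, cos_2PI, sin_2PI. f_equal; ring.
Qed.

Lemma shift_Z (X : Type) (f : R -> X) :
  (forall t, f (t + 1) = f t) -> forall (m : Z) t, f (t + IZR m) = f t.
Proof.
  intros H m.
  assert (P : forall (n : nat) t, f (t + INR n) = f t).
  { induction n as [| n IH]; intros t; [simpl; f_equal; ring |].
    rewrite S_INR, <- Rplus_assoc, H; apply IH. }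
  intros t. destruct (Z_le_dec 0 m).
  - rewrite <- (Z2Nat.id m) by assumption. rewrite <- INR_IZR_INZ. apply P.
  - rewrite <- (P (Z.to_nat (- m)) (t + IZR m)). f_equal.
    rewrite INR_IZR_INZ, Z2Nat.id by lia. rewrite opp_IZR. ring.
Qed.

Lemma e_shift_Z (m : Z) t : e (t + IZR m) = e t.
Proof. apply shift_Z, e_shift. Qed.

Lemma cross_e s t : cross (e s) (e t) = sin (2 * PI * (t - s)).
Proof.
  unfold cross, e; simpl.
  replace (2 * PI * (t - s)) with (2 * PI * t - 2 * PI * s) by ring.
  rewrite sin_minus. ring.
Qed.

Lemma e_inj s t : e s = e t -> exists m : Z, t = s + IZR m.
Proof.
  intros E.
  assert (D : fst (e s) * fst (e t) + snd (e s) * snd (e t) = 1) by (rewrite E; apply e_sqr).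
  unfold e in D; simpl in D.
  rewrite Rmult_comm, (Rmult_comm (sin _)), <- cos_minus in D.
  (* Halving the angle turns the equation [cos = 1] into [sin = 0], whose solutions are the
     multiples of [PI]. *)
  replace (2 * PI * t - 2 * PI * s) with (2 * (PI * (t - s))) in D by ring.
  rewrite cos_2a_sin in D.
  assert (Z : sin (PI * (t - s)) = 0) by nra.
  apply sin_eq_0_0 in Z. destruct Z as [m Hm]. exists m.
  pose proof PI_RGT_0.
  assert (t - s = IZR m); [| lra].
  apply Rmult_eq_reg_l with PI; lra.
Qed.

Lemma cross_e_pos s t : s < t < s + 1 / 2 -> 0 < cross (e s) (e t).
Proof.
  intros H. rewrite cross_e. pose proof PI_RGT_0. apply sin_gt_0; nra.
Qed.

Lemma polar p : p <> (0, 0) -> exists t, p = scal (pnorm p) (e t).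
Proof.
  intros N. pose proof (pnorm_pos p N) as Hr.
  assert (Hsq : pnorm p * pnorm p = fst p * fst p + snd p * snd p)
    by (unfold pnorm; apply sqrt_sqrt; nra).
  set (r := pnorm p) in *. destruct p as [x y]; simpl in *.
  assert (Hc : (x / r) * (x / r) + (y / r) * (y / r) = 1) by (field_simplify_eq; lra).
  set (c := x / r) in *. set (s := y / r) in *.
  assert (Hx : x = r * c) by (unfold c; field; lra).
  assert (Hy : y = r * s) by (unfold s; field; lra).
  assert (Bc : -1 <= c <= 1) by nra.
  assert (Hs : sqrt (1 - Rsqr c) = Rabs s).
  { replace (1 - Rsqr c) with (Rsqr s) by (unfold Rsqr; lra). apply sqrt_Rsqr_abs. }
  pose proof PI_RGT_0.
  destruct (Rle_dec 0 s) as [h | h].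
  - exists (acos c / (2 * PI)). unfold e, scal; simpl.
    replace (2 * PI * (acos c / (2 * PI))) with (acos c) by (field; lra).
    rewrite cos_acos, sin_acos, Hs, Rabs_right by lra. f_equal; assumption.
  - exists (- (acos c / (2 * PI))). unfold e, scal; simpl.
    replace (2 * PI * - (acos c / (2 * PI))) with (- acos c) by (field; lra).
    rewrite cos_neg, sin_neg, cos_acos, sin_acos, Hs, Rabs_left by lra. f_equal; lra.
Qed.

Lemma continuity_fst_e : continuity (fun t => fst (e t)).
Proof. unfold e; simpl. reg. Qed.

Lemma continuity_snd_e : continuity (fun t => snd (e t)).
Proof. unfold e; simpl. reg. Qed.

Lemma T_scal a b l p : 0 < l -> T a b (scal l p) = scal l (T a b p).
Proof.
  destruct p as [x y]; intros Hl; unfold scal, T; simpl.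
  destruct (Rle_dec 0 (l * x)); destruct (Rle_dec 0 x); simpl; try (f_equal; ring).
  - exfalso; nra.
  - exfalso; nra.
Qed.

Lemma T_neq_0 a b p : p <> (0, 0) -> T a b p <> (0, 0).
Proof.
  destruct p as [x y]; unfold T; intros N H.
  destruct (Rle_dec 0 x); injection H as H1 H2; apply N; subst; f_equal; lra.
Qed.

Lemma T_inj a b p q : T a b p = T a b q -> p = q.
Proof.
  destruct p as [x y], q as [z w]; unfold T; intros H.
  destruct (Rle_dec 0 x), (Rle_dec 0 z); injection H as H1 H2; subst; try tauto; f_equal; lra.
Qed.

Definition flip (p : pt) : pt := (snd p, fst p).

Lemma T_flip a b p : T a b (flip (T a b p)) = flip p.
Proof.
  destruct p as [x y]; unfold T, flip; simpl.
  destruct (Rle_dec 0 x); simpl; destruct (Rle_dec 0 x); try tauto; f_equal; ring.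
Qed.

Lemma iter_T_flip a b n p :
  Nat.iter n (T a b) (flip (Nat.iter n (T a b) p)) = flip p.
Proof.
  revert p; induction n as [| n IH]; intros p; [reflexivity |].
  rewrite Nat.iter_succ. rewrite (Nat.iter_succ_r n pt (T a b) p), IH. apply T_flip.
Qed.

Lemma iter_T_scal a b n l p :
  0 < l -> Nat.iter n (T a b) (scal l p) = scal l (Nat.iter n (T a b) p).
Proof.
  intros Hl; induction n as [| n IH]; [reflexivity |].
  simpl. rewrite IH. apply T_scal; assumption.
Qed.

Lemma iter_T_neq_0 a b n p : p <> (0, 0) -> Nat.iter n (T a b) p <> (0, 0).
Proof. intros N; induction n; [assumption | simpl; apply T_neq_0; assumption]. Qed.

Lemma T_eq_scal_S a b p : p <> (0, 0) -> T a b p = scal (pnorm (T a b p)) (S a b p).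
Proof.
  intros N. pose proof (pnorm_pos _ (T_neq_0 a b p N)).
  unfold S, scal; simpl. apply pt_eq; simpl; field; lra.
Qed.

Lemma S_neq_0 a b p : p <> (0, 0) -> S a b p <> (0, 0).
Proof.
  intros N H. apply (T_neq_0 a b p N). rewrite T_eq_scal_S, H by assumption.
  unfold scal; simpl; f_equal; ring.
Qed.

Lemma iter_T_eq_scal_S a b n p :
  p <> (0, 0) -> exists l, 0 < l /\ Nat.iter n (T a b) p = scal l (Nat.iter n (S a b) p).
Proof.
  intros N. induction n as [| n [l [Hl IH]]].
  - exists 1. split; [lra | simpl; rewrite scal_1; reflexivity].
  - assert (N' : Nat.iter n (S a b) p <> (0, 0)) by (clear IH; induction n; [assumption | simpl; apply S_neq_0; assumption]).
    exists (l * pnorm (T a b (Nat.iter n (S a b) p))). simpl. split.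
    + apply Rmult_lt_0_compat; [assumption | apply pnorm_pos, T_neq_0; assumption].
    + rewrite IH, T_scal, <- scal_scal, <- T_eq_scal_S by assumption. reflexivity.
Qed.

(* Conjugation by [flip] inverts [T] and sends [(0, s)] to [T (0, - s)];
   applied to [T^n (0, s) = l (0, - s)] it gives [l * l = 1]. *)
Lemma orbit_joins_poles a b s n :
  s = 1 \/ s = -1 -> Nat.iter n (S a b) (0, s) = (0, - s) ->
  Nat.iter n (T a b) (0, s) = (0, - s).
Proof.
  intros Hs E.
  assert (N : (0, s) <> (0, 0)) by (intros H; injection H; intros; lra).
  destruct (iter_T_eq_scal_S a b n (0, s) N) as [l [Hl El]].
  rewrite E in El.
  pose proof (iter_T_flip a b n (0, s)) as R1.
  assert (R2 : flip (Nat.iter n (T a b) (0, s)) = scal l (T a b (0, s))).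
  { rewrite El. unfold flip, scal, T; simpl. destruct (Rle_dec 0 0); [| lra].
    simpl; f_equal; ring. }
  rewrite R2, iter_T_scal, <- Nat.iter_succ_r, Nat.iter_succ, El, T_scal, scal_scal in R1 by assumption.
  unfold flip, scal, T in R1; simpl in R1.
  destruct (Rle_dec 0 0); [| lra]. simpl in R1; injection R1 as R1 _.
  assert (l * l = 1) by (destruct Hs; subst s; lra).
  assert (l = 1) by nra. subst l. rewrite scal_1 in El. exact El.
Qed.

(** * Lifts of [S] *)

Definition lift (a b : R) (F : R -> R) : Prop :=
  continuity F /\ (forall t, F (t + 1) = F t + 1) /\ (forall t, S a b (e t) = e (F t)).

Definition rho (a b t : R) : R := pnorm (T a b (e t)).

Lemma rho_pos a b t : 0 < rho a b t.
Proof. apply pnorm_pos, T_neq_0, e_neq_0. Qed.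

Lemma rho_shift a b t : rho a b (t + 1) = rho a b t.
Proof. unfold rho. rewrite e_shift. reflexivity. Qed.

Lemma T_e a b F t : lift a b F -> T a b (e t) = scal (rho a b t) (e (F t)).
Proof.
  intros [_ [_ H]]. rewrite <- H. apply T_eq_scal_S, e_neq_0.
Qed.

Lemma lift_shift_Z a b F (m : Z) t : lift a b F -> F (t + IZR m) = F t + IZR m.
Proof.
  intros [_ [H _]].
  pose proof (shift_Z R (fun t => F t - t)) as P. cbv beta in P.
  specialize (P ltac:(intros u; rewrite H; ring) m t). lra.
Qed.

Lemma lift_inj a b F s t : lift a b F -> F s = F t -> s = t.
Proof.
  intros HF E. pose proof (T_e a b F s HF) as Ts. pose proof (T_e a b F t HF) as Tt.
  pose proof (rho_pos a b s) as Ps. pose proof (rho_pos a b t) as Pt.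
  assert (El : e s = scal (rho a b s / rho a b t) (e t)).
  { apply (T_inj a b). rewrite T_scal by (apply Rdiv_lt_0_compat; assumption).
    rewrite Ts, Tt, scal_scal, E. f_equal. field. lra. }
  assert (Hl : rho a b s / rho a b t = 1).
  { pose proof (pnorm_e s) as N. rewrite El, pnorm_scal, pnorm_e in N; [lra |].
    apply Rlt_le, Rdiv_lt_0_compat; assumption. }
  rewrite Hl, scal_1 in El. apply e_inj in El. destruct El as [m ->].
  rewrite (lift_shift_Z a b F m s HF) in E. lra.
Qed.

Lemma IVT_value (f : R -> R) x y v :
  continuity f -> x <= y -> f x <= v <= f y -> exists z, x <= z <= y /\ f z = v.
Proof.
  intros Hf Hxy Hv.
  destruct (Req_dec (f x) v) as [E1 | N1]; [exists x; split; [lra | assumption] |].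
  destruct (Req_dec (f y) v) as [E2 | N2]; [exists y; split; [lra | assumption] |].
  assert (x < y) by (destruct Hxy as [h | h]; [assumption | subst; exfalso; lra]).
  destruct (IVT (fun t => f t - v) x y) as [z [Hz1 Hz2]]; try lra.
  - apply continuity_minus; [assumption | apply continuity_const; intros ? ?; reflexivity].
  - exists z; split; [assumption | lra].
Qed.

(** Injectivity and degree one suffice. If [F] went down from [s] to [t], it would have to climb
    back through the value [F s] somewhere in [[t, t + m]], because [F (t + m) = F t + m]. *)
Lemma lift_incr a b F s t : lift a b F -> s < t -> F s < F t.
Proof.
  intros HF Hst. apply Rnot_le_lt; intros H.
  assert (Hlt : F t < F s).
  { destruct H as [h | h]; [assumption |]. apply (lift_inj a b F t s HF) in h. lra. }
  destruct (archimed (F s - F t)) as [A _].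
  set (m := up (F s - F t)) in A.
  assert (Hm : 0 < IZR m) by lra.
  destruct (IVT_value F t (t + IZR m) (F s)) as [z [Hz1 Hz2]].
  - apply HF.
  - lra.
  - rewrite (lift_shift_Z a b F m t HF); lra.
  - apply (lift_inj a b F z s HF) in Hz2. lra.
Qed.

Lemma lift_surj a b F v : lift a b F -> exists z, F z = v.
Proof.
  intros HF. destruct (floor_exists (v - F 0)) as [m Hm].
  destruct (IVT_value F (0 + IZR m) (0 + IZR (m + 1)) v) as [z [_ Hz]].
  - apply HF.
  - rewrite plus_IZR; lra.
  - rewrite !(lift_shift_Z a b F _ 0 HF), plus_IZR. lra.
  - exists z; exact Hz.
Qed.

Lemma iter_lift_shift_Z a b F n (m : Z) t :
  lift a b F -> Nat.iter n F (t + IZR m) = Nat.iter n F t + IZR m.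
Proof.
  intros HF; induction n as [| n IH]; simpl; [reflexivity |].
  rewrite IH. apply (lift_shift_Z a b F m _ HF).
Qed.

Lemma iter_lift_incr a b F n s t : lift a b F -> s < t -> Nat.iter n F s < Nat.iter n F t.
Proof.
  intros HF H; induction n as [| n IH]; simpl; [assumption |].
  apply (lift_incr a b F _ _ HF IH).
Qed.

Lemma iter_S_e a b F n t : lift a b F -> Nat.iter n (S a b) (e t) = e (Nat.iter n F t).
Proof.
  intros HF; induction n as [| n IH]; simpl; [reflexivity |]. rewrite IH. apply HF.
Qed.

Lemma iter_lift_period a b F n i (m : Z) t :
  lift a b F -> Nat.iter n F t = t + IZR m ->
  Nat.iter (i * n) F t = t + INR i * IZR m.
Proof.
  intros HF H. induction i as [| i IH].
  - simpl; ring.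
  - change (Datatypes.S i * n)%nat with (n + i * n)%nat.
    rewrite Nat.iter_add, IH, INR_IZR_INZ, <- mult_IZR.
    rewrite (iter_lift_shift_Z a b F n _ t HF), H, mult_IZR, <- INR_IZR_INZ, S_INR. ring.
Qed.

(** An orbit that is periodic modulo 1 advances at the exact rate [m / n]. Monotonicity keeps the
    orbit of [0] at bounded distance from it, so the limit [r] would be [m / n]. *)
Lemma lift_aperiodic a b F r n (m : Z) t :
  lift a b F -> Un_cv (fun k => Nat.iter k F 0 / INR k) r -> irrational r ->
  (0 < n)%nat -> Nat.iter n F t <> t + IZR m.
Proof.
  intros HF Hcv Hirr Hn E. apply Hirr.
  exists m, (Z.of_nat n). split; [lia |]. rewrite <- INR_IZR_INZ.
  assert (Pn : 0 < INR n) by (apply lt_0_INR; assumption).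
  apply NNPP; intros N.
  set (d := Rabs (r - IZR m / INR n)).
  assert (Hd : 0 < d) by (apply Rabs_pos_lt; lra).
  destruct (archimed (Rabs t)) as [A _]. set (K := up (Rabs t)) in A.
  destruct (Hcv (d / 2)) as [N0 HN0]; [lra |].
  destruct (archimed ((2 * IZR K) * / (d / 2 * INR n))) as [B _].
  (* Since [K] exceeds [Rabs t], the iterate of [0] of order [i * n] differs from [i * m] by less
     than [2 * K]. With [i > j] this becomes less than [d / 2] after division by [i * n]. *)
  set (j := up (2 * IZR K * / (d / 2 * INR n))) in B.
  pose proof (Rabs_pos t) as At.
  assert (Hdn : 0 < d / 2 * INR n) by (apply Rmult_lt_0_compat; lra).
  assert (Hj : 0 < IZR j).
  { apply Rle_lt_trans with (2 * IZR K * / (d / 2 * INR n)); [| assumption].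
    apply Rmult_le_pos; [lra | apply Rlt_le, Rinv_0_lt_compat; assumption]. }
  set (i := (Z.to_nat j + N0 + 1)%nat).
  assert (Hi : IZR j < INR i).
  { unfold i. apply lt_IZR in Hj. rewrite !plus_INR, (INR_IZR_INZ (Z.to_nat j)), Z2Nat.id by lia.
    pose proof (pos_INR N0). simpl; lra. }
  assert (Hin : (i * n >= N0)%nat) by (unfold i; nia).
  specialize (HN0 _ Hin). unfold Rdist in HN0.
  pose proof (iter_lift_period a b F n i m t HF E) as P.
  assert (Bt : - IZR K < t < IZR K) by (destruct (Rabs_def2 t (IZR K) A); lra).
  assert (U1 : Nat.iter (i * n) F t < Nat.iter (i * n) F 0 + IZR K).
  { rewrite <- (iter_lift_shift_Z a b F _ K 0 HF). apply (iter_lift_incr a b F _ _ _ HF); lra. }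
  assert (U2 : Nat.iter (i * n) F 0 + IZR (- K) < Nat.iter (i * n) F t).
  { rewrite <- (iter_lift_shift_Z a b F _ (- K) 0 HF). apply (iter_lift_incr a b F _ _ _ HF).
    rewrite opp_IZR; lra. }
  rewrite opp_IZR in U2. rewrite P in U1, U2.
  set (z := Nat.iter (i * n) F 0) in *.
  rewrite mult_INR in HN0.
  assert (Pin : 0 < INR i * INR n) by (apply Rmult_lt_0_compat; lra).
  assert (C : Rabs (z / (INR i * INR n) - IZR m / INR n) < d / 2).
  { replace (z / (INR i * INR n) - IZR m / INR n)
      with ((z - INR i * IZR m) / (INR i * INR n)) by (field; lra).
    assert (G : 2 * IZR K < d / 2 * (INR i * INR n)).
    { replace (2 * IZR K) with (2 * IZR K * / (d / 2 * INR n) * (d / 2 * INR n)) by (field; lra).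
      apply Rlt_le_trans with (IZR j * (d / 2 * INR n)); nra. }
    apply Rabs_def1.
    - apply Rmult_lt_reg_r with (INR i * INR n); [assumption |].
      unfold Rdiv at 1. rewrite Rmult_assoc, Rinv_l by lra. lra.
    - apply Rmult_lt_reg_r with (INR i * INR n); [assumption |].
      unfold Rdiv at 2. rewrite Rmult_assoc, Rinv_l by lra. lra. }
  assert (d < d / 2 + d / 2); [| lra].
  unfold d at 1.
  replace (r - IZR m / INR n)
    with ((z / (INR i * INR n) - IZR m / INR n) - (z / (INR i * INR n) - r)) by ring.
  eapply Rle_lt_trans; [apply Rabs_triang |]. rewrite Rabs_Ropp. lra.
Qed.

(** * Step functions jumping by shears *)

Lemma Int_part_eq (r : R) (m : Z) : IZR m <= r < IZR m + 1 -> Int_part r = m.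
Proof.
  intros H. apply (IZR_unit_eq _ _ r); [destruct (base_Int_part r); lra | assumption].
Qed.

(** Indicator of [beta + Z], the set of all lifts of one ray. *)
Definition ind (beta t : R) : R :=
  if Req_dec_T (t - beta) (IZR (Int_part (t - beta))) then 1 else 0.

Lemma ind_translate (beta : R) (m : Z) : ind beta (beta + IZR m) = 1.
Proof.
  unfold ind. destruct Req_dec_T as [_ | N]; [reflexivity |]. exfalso; apply N.
  replace (beta + IZR m - beta) with (IZR m) by ring.
  rewrite (Int_part_eq _ m); lra.
Qed.

Lemma ind_other (beta t : R) : (forall m : Z, t <> beta + IZR m) -> ind beta t = 0.
Proof.
  intros H. unfold ind. destruct Req_dec_T as [E | _]; [| reflexivity].
  exfalso; apply (H (Int_part (t - beta))). lra.
Qed.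

Lemma ind_spec (beta t : R) :
  (exists m : Z, t = beta + IZR m /\ ind beta t = 1) \/
  ((forall m : Z, t <> beta + IZR m) /\ ind beta t = 0).
Proof.
  destruct (classic (exists m : Z, t = beta + IZR m)) as [[m ->] | N].
  - left; exists m. split; [reflexivity | apply ind_translate].
  - right. assert (N' : forall m : Z, t <> beta + IZR m) by (intros m E; apply N; exists m; exact E).
    split; [assumption | apply ind_other; assumption].
Qed.

Lemma ind_shift (beta t : R) : ind beta (t + 1) = ind beta t.
Proof.
  destruct (ind_spec beta t) as [[m [-> ->]] | [N ->]].
  - replace (beta + IZR m + 1) with (beta + IZR (m + 1)) by (rewrite plus_IZR; ring).
    apply ind_translate.
  - apply ind_other. intros m E. apply (N (m - 1)%Z). rewrite minus_IZR. lra.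
Qed.

(** [H t] stands for the derivative, on the sector just after the direction
    [e t], of a continuous piecewise linear map on the universal cover of the
    punctured plane: shears along [e t] are the jumps that keep it continuous
    across that ray. *)
Definition has_jumps (H : R -> mat) (K : R -> R) : Prop :=
  forall t, exists d, 0 < d /\
    (forall s, t <= s < t + d -> H s = H t) /\
    (forall s, t - d < s < t -> H t = mmul (H s) (shear (e t) (K t))).

(** The recursion starts from the identity at [0]; [P] solves it upwards and [Q] downwards, with
    inverse factors. *)
Lemma Z_indexed_products (N : Z -> mat) :
  (forall m, mdet (N m) = 1) ->
  exists G : Z -> mat, (forall m, mdet (G m) = 1) /\
    forall m, G m = mmul (G (m - 1)%Z) (N m).
Proof.
  intros HN.
  pose (P := fix P (n : nat) := match n with
    | O => mid | Datatypes.S n' => mmul (P n') (N (Z.of_nat n)) end).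
  pose (Q := fix Q (n : nat) := match n with
    | O => mid | Datatypes.S n' => mmul (Q n') (madj (N (- Z.of_nat n')%Z)) end).
  assert (PS : forall n, P (Datatypes.S n) = mmul (P n) (N (Z.of_nat (Datatypes.S n))))
    by reflexivity.
  assert (QS : forall n, Q (Datatypes.S n) = mmul (Q n) (madj (N (- Z.of_nat n)%Z)))
    by reflexivity.
  assert (DP : forall n, mdet (P n) = 1).
  { induction n as [| n IH]; [unfold mdet; simpl; ring |].
    rewrite PS. rewrite mdet_mmul, IH, HN. ring. }
  assert (DQ : forall n, mdet (Q n) = 1).
  { induction n as [| n IH]; [unfold mdet; simpl; ring |].
    rewrite QS. rewrite mdet_mmul, IH, mdet_madj, HN. ring. }
  exists (fun m => if Z_lt_dec 0 m then P (Z.to_nat m) else Q (Z.to_nat (- m))).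
  split; intros m.
  - destruct Z_lt_dec; auto.
  - destruct (Z_lt_dec 0 m) as [h | h].
    + replace (Z.to_nat m) with (Datatypes.S (Z.to_nat (m - 1))) by lia.
      rewrite PS. replace (Z.of_nat (Datatypes.S (Z.to_nat (m - 1)))) with m by lia.
      destruct (Z_lt_dec 0 (m - 1)) as [h' | h']; [reflexivity |].
      replace m with 1%Z by lia. reflexivity.
    + destruct (Z_lt_dec 0 (m - 1)) as [h' | h']; [lia |].
      replace (Z.to_nat (- (m - 1))) with (Datatypes.S (Z.to_nat (- m))) by lia.
      rewrite QS. replace (- Z.of_nat (Z.to_nat (- m)))%Z with m by lia.
      rewrite <- mmul_assoc, mmul_madj_l, mmul_1_r by apply HN. reflexivity.
Qed.

(** Jumps multiply [H] on the right, so a left factor that is constant between consecutive lifts of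
    [beta] leaves the old ones alone. At a lift of [beta] the factor changes by the required shear
    conjugated by [H] there, which reappears unconjugated on the right. *)
Lemma has_jumps_add_break (H : R -> mat) (K : R -> R) (beta k : R) :
  (forall t, mdet (H t) = 1) -> has_jumps H K ->
  exists H', (forall t, mdet (H' t) = 1) /\
    has_jumps H' (fun t => K t + k * ind beta t).
Proof.
  intros DH JH.
  set (N := fun m : Z => mmul (mmul (H (beta + IZR m)) (shear (e beta) k))
                               (madj (H (beta + IZR m)))).
  destruct (Z_indexed_products N) as [G [DG HG]].
  { intros m. unfold N. rewrite !mdet_mmul, mdet_madj, mdet_shear, !DH. ring. }
  exists (fun t => mmul (G (Int_part (t - beta))) (H t)).
  split; [intros t; rewrite mdet_mmul, DG, DH; ring |].
  intros t. destruct (JH t) as [d [Hd [Hr Hl]]].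
  destruct (ind_spec beta t) as [[m [Et ->]] | [Ne ->]].
  - assert (Em : Int_part (t - beta) = m) by (apply Int_part_eq; lra).
    exists (Rmin d 1). split; [apply Rmin_pos; lra |].
    pose proof (Rmin_l d 1). pose proof (Rmin_r d 1). rewrite Em. split; intros s Hs.
    + rewrite (Int_part_eq (s - beta) m), (Hr s) by lra. reflexivity.
    + rewrite (Int_part_eq (s - beta) (m - 1)) by (rewrite minus_IZR; lra).
      rewrite (HG m). unfold N. rewrite <- Et.
      assert (Ee : e beta = e t) by (rewrite Et; symmetry; apply e_shift_Z).
      rewrite Ee, <- !mmul_assoc, mmul_madj_l, mmul_1_r by apply DH.
      rewrite Rmult_1_r, <- shear_add, (Hl s) by lra. rewrite <- !mmul_assoc. reflexivity.
  - set (m := Int_part (t - beta)).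
    assert (Bm : IZR m < t - beta < IZR m + 1).
    { destruct (base_Int_part (t - beta)) as [B1 B2]. fold m in B1, B2.
      specialize (Ne m). split; lra. }
    set (d' := Rmin d (Rmin (t - beta - IZR m) (IZR m + 1 - (t - beta)))).
    assert (D1 : d' <= d) by apply Rmin_l.
    assert (D2 : d' <= t - beta - IZR m) by (eapply Rle_trans; [apply Rmin_r | apply Rmin_l]).
    assert (D3 : d' <= IZR m + 1 - (t - beta)) by (eapply Rle_trans; [apply Rmin_r | apply Rmin_r]).
    exists d'. split; [repeat apply Rmin_pos; lra |]. split; intros s Hs.
    + rewrite (Int_part_eq (s - beta) m), (Hr s) by lra. reflexivity.
    + rewrite (Int_part_eq (s - beta) m), (Hl s) by lra.
      rewrite Rmult_0_r, Rplus_0_r, <- mmul_assoc. reflexivity.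
Qed.

Fixpoint jump_sum (beta k : nat -> R) (n : nat) (t : R) : R :=
  match n with
  | O => 0
  | Datatypes.S n' => jump_sum beta k n' t + k n' * ind (beta n') t
  end.

Lemma has_jumps_exists (beta k : nat -> R) (n : nat) :
  exists H, (forall t, mdet (H t) = 1) /\ has_jumps H (jump_sum beta k n).
Proof.
  induction n as [| n [H [DH JH]]].
  - exists (fun _ => mid). split; [intros; unfold mdet; simpl; ring |].
    intros t. exists 1. split; [lra |]. split; intros s _; [reflexivity |].
    simpl. rewrite shear_0, mmul_1_r. reflexivity.
  - exact (has_jumps_add_break H _ (beta n) (k n) DH JH).
Qed.

Lemma jump_sum_shift beta k n t : jump_sum beta k n (t + 1) = jump_sum beta k n t.
Proof. induction n as [| n IH]; simpl; [reflexivity |]. rewrite IH, ind_shift. reflexivity. Qed.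

Lemma has_jumps_0_constant H :
  has_jumps H (fun _ => 0) -> forall s t, H s = H t.
Proof.
  intros J. apply locally_constant_eq. intros t.
  destruct (J t) as [d [Hd [Hr Hl]]]. exists d. split; [assumption |].
  intros s Hs. destruct (Rle_lt_dec t s) as [h | h].
  - apply Hr; lra.
  - rewrite (Hl s) by lra. rewrite shear_0, mmul_1_r. reflexivity.
Qed.

(** [H (t + 1)] and [H t] undergo the same right jump, so it cancels in [H (t + 1) (H t)^-1], which
    is therefore constant. *)
Lemma has_jumps_monodromy H K :
  (forall t, mdet (H t) = 1) -> has_jumps H K -> (forall t, K (t + 1) = K t) ->
  exists M, mdet M = 1 /\ forall t, H (t + 1) = mmul M (H t).
Proof.
  intros DH J HK.
  set (X := fun t => mmul (H (t + 1)) (madj (H t))).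
  assert (C : forall s t, X s = X t).
  { apply has_jumps_0_constant. intros t.
    destruct (J t) as [d1 [Hd1 [R1 L1]]]. destruct (J (t + 1)) as [d2 [Hd2 [R2 L2]]].
    pose proof (Rmin_l d1 d2). pose proof (Rmin_r d1 d2).
    exists (Rmin d1 d2). split; [apply Rmin_pos; assumption |]. unfold X. split; intros s Hs.
    - rewrite (R1 s), (R2 (s + 1)) by lra. reflexivity.
    - rewrite shear_0, mmul_1_r, (L1 s), (L2 (s + 1)), e_shift, HK by lra.
      rewrite madj_mmul, madj_shear, <- mmul_assoc, (mmul_assoc (shear _ _)), shear_add.
      replace (K t + - K t) with 0 by ring. rewrite shear_0, mmul_1_l. reflexivity. }
  exists (X 0). split.
  - unfold X. rewrite mdet_mmul, mdet_madj, !DH. ring.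
  - intros t. rewrite (C 0 t). unfold X.
    rewrite <- mmul_assoc, mmul_madj_l, mmul_1_r by apply DH. reflexivity.
Qed.

(** * Linearizing [T] on the universal cover *)

Lemma e_quarter : e (1 / 4) = (0, 1).
Proof.
  unfold e. replace (2 * PI * (1 / 4)) with (PI / 2) by field.
  rewrite cos_PI2, sin_PI2. reflexivity.
Qed.

Lemma e_minus_quarter : e (- (1 / 4)) = (0, -1).
Proof.
  unfold e. replace (2 * PI * - (1 / 4)) with (- (PI / 2)) by field.
  rewrite cos_neg, sin_neg, cos_PI2, sin_PI2. reflexivity.
Qed.

Lemma fst_e_cross t : fst (e t) = cross (e t) (e (1 / 4)).
Proof. rewrite e_quarter. unfold cross; simpl; ring. Qed.

Lemma fst_e_cross' t : fst (e t) = cross (e (- (1 / 4))) (e t).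
Proof. rewrite e_minus_quarter. unfold cross; simpl; ring. Qed.

Lemma cross_anti p q : cross p q = - cross q p.
Proof. unfold cross; ring. Qed.

Lemma continuity_near (f : R -> R) t eps :
  continuity f -> 0 < eps ->
  exists d, 0 < d /\ forall s, t - d < s < t + d -> Rabs (f s - f t) < eps.
Proof.
  intros Hf He. destruct (Hf t eps He) as [d [Hd H]]. exists d. split; [exact Hd |].
  intros s Hs. destruct (Req_dec t s) as [<- | N].
  - replace (f t - f t) with 0 by ring. rewrite Rabs_R0. assumption.
  - apply H. split; [split; [exact I | assumption] |].
    simpl. unfold Rdist. apply Rabs_def1; lra.
Qed.

Lemma continuity_pos_near (f : R -> R) t :
  continuity f -> 0 < f t -> exists d, 0 < d /\ forall s, t - d < s < t + d -> 0 < f s.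
Proof.
  intros Hf Hp. destruct (continuity_near f t (f t) Hf Hp) as [d [Hd H]].
  exists d. split; [assumption |]. intros s Hs. specialize (H s Hs).
  apply Rabs_def2 in H. lra.
Qed.

(** * The derivative of [T] and its two jumps *)

Definition branch (u : R) : mat := Mat u (-1) 1 0.

(* At the two poles the value is the one-sided derivative in the direction of
   increasing [t]. *)
Definition slope (a b t : R) : mat :=
  if Rlt_dec 0 (fst (e t)) then branch a
  else if Rlt_dec (fst (e t)) 0 then branch b
  else if Rlt_dec 0 (snd (e t)) then branch b else branch a.

Lemma mdet_slope a b t : mdet (slope a b t) = 1.
Proof.
  unfold slope. destruct Rlt_dec; [| destruct Rlt_dec; [| destruct Rlt_dec]];
  unfold mdet; simpl; ring.
Qed.

Lemma mapp_slope a b t : mapp (slope a b t) (e t) = T a b (e t).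
Proof.
  unfold slope, T. destruct (e t) as [x y]; simpl.
  destruct (Rlt_dec 0 x); [| destruct (Rlt_dec x 0)]; destruct (Rle_dec 0 x);
    try (exfalso; lra); try (unfold mapp; simpl; f_equal; ring).
  assert (x = 0) by lra; subst.
  destruct Rlt_dec; unfold mapp; simpl; f_equal; ring.
Qed.

Lemma slope_shift a b t : slope a b (t + 1) = slope a b t.
Proof. unfold slope. rewrite e_shift. reflexivity. Qed.

Lemma slope_right a b t : 0 < fst (e t) -> slope a b t = branch a.
Proof. intros H. unfold slope. destruct Rlt_dec; [reflexivity | lra]. Qed.

Lemma slope_left a b t : fst (e t) < 0 -> slope a b t = branch b.
Proof.
  intros H. unfold slope. destruct Rlt_dec; [lra |]. destruct Rlt_dec; [reflexivity | lra].
Qed.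

(** The two branches agree on the vertical axis, hence differ by a shear along it. Counterclockwise,
    the upper pole passes from [branch a] to [branch b] and the lower pole back. *)
Definition slope_jump (a b t : R) : R := (b - a) * ind (1 / 4) t + (a - b) * ind (- (1 / 4)) t.

Lemma ind_pole_0 beta t : fst (e beta) = 0 -> fst (e t) <> 0 -> ind beta t = 0.
Proof. intros E N. apply ind_other. intros m ->. apply N. rewrite e_shift_Z. assumption. Qed.

Lemma has_jumps_slope a b : has_jumps (slope a b) (slope_jump a b).
Proof.
  intros t. unfold slope_jump.
  destruct (Rtotal_order (fst (e t)) 0) as [h | [h | h]].
  - destruct (continuity_pos_near (fun s => - fst (e s)) t) as [d [Hd H]].
    { apply continuity_opp, continuity_fst_e. } { lra. }
    exists d. split; [assumption |]. rewrite (slope_left a b t h).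
    split; intros s Hs; rewrite (slope_left a b s) by (specialize (H s); lra); [reflexivity |].
    rewrite !ind_pole_0 by (rewrite ?e_quarter, ?e_minus_quarter; (reflexivity || (intros ?; lra))).
    replace ((b - a) * 0 + (a - b) * 0) with 0 by ring. rewrite shear_0, mmul_1_r. reflexivity.
  - assert (Hy : snd (e t) = 1 \/ snd (e t) = -1).
    { pose proof (e_sqr t) as E. rewrite h in E.
      assert (P : (snd (e t) - 1) * (snd (e t) + 1) = 0) by lra.
      apply Rmult_integral in P. destruct P; [left | right]; lra. }
    (* The half turn on either side of a pole is an open half-plane, where [slope] is constant. *)
    exists (1 / 2). split; [lra |].
    destruct Hy as [Hy | Hy].
    + assert (Et : e t = e (1 / 4)) by (rewrite e_quarter; apply pt_eq; assumption).
      destruct (e_inj _ _ (eq_sym Et)) as [m Em].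
      assert (St : slope a b t = branch b).
      { unfold slope. rewrite h, Hy. repeat (destruct Rlt_dec; try lra). reflexivity. }
      rewrite St. split; intros s Hs.
      * destruct (Req_dec s t) as [-> | N]; [assumption |].
        apply slope_left. rewrite fst_e_cross, <- Et, cross_anti.
        pose proof (cross_e_pos t s). lra.
      * rewrite (slope_right a b s) by (rewrite fst_e_cross, <- Et; apply cross_e_pos; lra).
        rewrite Em at 2 3. rewrite ind_translate, ind_other.
        -- rewrite Et, e_quarter. unfold mmul, shear, branch; simpl. f_equal; ring.
        -- intros k Ek. assert (Eq : e (1 / 4) = e (- (1 / 4)))
             by (rewrite <- (e_shift_Z m), Ek, e_shift_Z; reflexivity).
           rewrite e_quarter, e_minus_quarter in Eq. injection Eq; lra.
    + assert (Et : e t = e (- (1 / 4))) by (rewrite e_minus_quarter; apply pt_eq; assumption).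
      destruct (e_inj _ _ (eq_sym Et)) as [m Em].
      assert (St : slope a b t = branch a).
      { unfold slope. rewrite h, Hy. repeat (destruct Rlt_dec; try lra). reflexivity. }
      rewrite St. split; intros s Hs.
      * destruct (Req_dec s t) as [-> | N]; [assumption |].
        apply slope_right. rewrite fst_e_cross', <- Et. apply cross_e_pos; lra.
      * rewrite (slope_left a b s).
        2: { rewrite fst_e_cross', <- Et, cross_anti. pose proof (cross_e_pos s t). lra. }
        rewrite Em at 2 3. rewrite (ind_translate (- (1 / 4))), ind_other.
        -- rewrite Et, e_minus_quarter. unfold mmul, shear, branch; simpl. f_equal; ring.
        -- intros k Ek. assert (Eq : e (1 / 4) = e (- (1 / 4)))
             by (rewrite <- (e_shift_Z m (- (1 / 4))), Ek, e_shift_Z; reflexivity).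
           rewrite e_quarter, e_minus_quarter in Eq. injection Eq; lra.
  - destruct (continuity_pos_near (fun s => fst (e s)) t) as [d [Hd H]].
    { apply continuity_fst_e. } { lra. }
    exists d. split; [assumption |]. rewrite (slope_right a b t h).
    split; intros s Hs; rewrite (slope_right a b s) by (apply H; lra); [reflexivity |].
    rewrite !ind_pole_0 by (rewrite ?e_quarter, ?e_minus_quarter; (reflexivity || (intros ?; lra))).
    replace ((b - a) * 0 + (a - b) * 0) with 0 by ring. rewrite shear_0, mmul_1_r. reflexivity.
Qed.

(** The equation on [K] says that no jump survives in [H (F t) (slope t) (H t)^-1]. Moving the jump
    of [slope] and that of [H t] to the left of [slope] turns shears along [e t] into shears along
    [rho * e (F t)], whence the factor [rho] squared. *)
Lemma has_jumps_linearizes a b F H K :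
  lift a b F -> (forall t, mdet (H t) = 1) -> has_jumps H K ->
  (forall t, K (F t) = (K t - slope_jump a b t) * rho a b t * rho a b t) ->
  exists L, mdet L = 1 /\ forall t, mmul (H (F t)) (slope a b t) = mmul L (H t).
Proof.
  intros HF DH J HK.
  set (X := fun t => mmul (mmul (H (F t)) (slope a b t)) (madj (H t))).
  assert (C : forall s t, X s = X t).
  { apply has_jumps_0_constant. intros t.
    destruct (J t) as [d1 [Hd1 [R1 L1]]]. destruct (J (F t)) as [d2 [Hd2 [R2 L2]]].
    destruct (has_jumps_slope a b t) as [d3 [Hd3 [R3 L3]]].
    destruct (continuity_near F t d2 (proj1 HF) Hd2) as [d4 [Hd4 C4]].
    set (d := Rmin (Rmin d1 d3) d4).
    assert (E4 : d <= d4) by apply Rmin_r.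
    assert (E1 : d <= d1) by (eapply Rle_trans; [apply Rmin_l | apply Rmin_l]).
    assert (E3 : d <= d3) by (eapply Rle_trans; [apply Rmin_l | apply Rmin_r]).
    exists d. split; [repeat apply Rmin_pos; assumption |]. unfold X. split; intros s Hs.
    - destruct (Req_dec s t) as [-> | N]; [reflexivity |].
      assert (M : F t < F s) by (apply (lift_incr a b F _ _ HF); lra).
      specialize (C4 s ltac:(lra)). apply Rabs_def2 in C4.
      rewrite (R1 s), (R2 (F s)), (R3 s) by lra. reflexivity.
    - assert (M : F s < F t) by (apply (lift_incr a b F _ _ HF); lra).
      specialize (C4 s ltac:(lra)). apply Rabs_def2 in C4.
      rewrite shear_0, mmul_1_r.
      (* The matrix valid just before [t] already sends [e t] to [T (e t)], because the jump at [t]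
         is a shear fixing [e t]. *)
      assert (Es : mapp (slope a b s) (e t) = scal (rho a b t) (e (F t))).
      { rewrite <- (T_e a b F t HF), <- mapp_slope, (L3 s) by lra.
        rewrite mapp_mmul, shear_self. reflexivity. }
      rewrite (L1 s), (L2 (F s)), (L3 s) by lra.
      rewrite HK, <- shear_scal, madj_mmul, madj_shear, <- !mmul_assoc. f_equal.
      rewrite (mmul_assoc (shear (e t) _)), shear_add, (mmul_assoc (slope a b s)).
      rewrite mmul_shear, Es by apply mdet_slope.
      rewrite <- mmul_assoc, (mmul_assoc (shear _ _)), shear_add.
      replace (K t - slope_jump a b t + (slope_jump a b t + - K t)) with 0 by ring.
      rewrite shear_0, mmul_1_l. reflexivity. }
  exists (X 0). split.
  - unfold X. rewrite !mdet_mmul, mdet_madj, !DH, mdet_slope. ring.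
  - intros t. rewrite (C 0 t). unfold X.
    rewrite <- (mmul_assoc _ (madj _)), mmul_madj_l, mmul_1_r by apply DH. reflexivity.
Qed.

Lemma ind_lift a b F beta t : lift a b F -> ind (F beta) (F t) = ind beta t.
Proof.
  intros HF. destruct (ind_spec beta t) as [[m [-> ->]] | [N ->]].
  - rewrite (lift_shift_Z a b F m beta HF). apply ind_translate.
  - apply ind_other. intros m E. apply (N m).
    rewrite <- (lift_shift_Z a b F m beta HF) in E. apply (lift_inj a b F _ _ HF E).
Qed.

Lemma rho_shift_Z a b (m : Z) t : rho a b (t + IZR m) = rho a b t.
Proof. apply shift_Z. intros; apply rho_shift. Qed.

Lemma iter_T_e a b F n t :
  lift a b F ->
  Nat.iter n (T a b) (e t) = scal (pnorm (Nat.iter n (T a b) (e t))) (e (Nat.iter n F t)).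
Proof.
  intros HF. destruct (iter_T_eq_scal_S a b n (e t) (e_neq_0 t)) as [l [Hl E]].
  rewrite (iter_S_e a b F n t HF) in E. rewrite E, pnorm_scal, pnorm_e by lra.
  f_equal; ring.
Qed.

Lemma pnorm_iter_succ a b F n t :
  lift a b F ->
  pnorm (Nat.iter (Datatypes.S n) (T a b) (e t)) =
  pnorm (Nat.iter n (T a b) (e t)) * rho a b (Nat.iter n F t).
Proof.
  intros HF. pose proof (pnorm_pos _ (iter_T_neq_0 a b n (e t) (e_neq_0 t))) as Hp.
  simpl. rewrite (iter_T_e a b F n t HF) at 1.
  rewrite T_scal, pnorm_scal by lra. reflexivity.
Qed.

(** * Transport of a jump along the orbit of a pole *)

Section Orbit.
Context (a b : R) (F : R -> R) (beta0 c : R) (HF : lift a b F).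

Let beta (j : nat) : R := Nat.iter j F beta0.
Let weight (j : nat) : R :=
  c * (pnorm (Nat.iter j (T a b) (e beta0)) * pnorm (Nat.iter j (T a b) (e beta0))).
Let next_beta (j : nat) : R := beta (Datatypes.S j).
Let next_weight (j : nat) : R := weight (Datatypes.S j).

(** The squared norm in [weight] is the product of the squared stretches so far, so one application
    of [F] just shifts the index of every jump. *)
Lemma jump_sum_lift n t :
  jump_sum next_beta next_weight n (F t) = jump_sum beta weight n t * rho a b t * rho a b t.
Proof.
  induction n as [| n IH]; simpl; [ring |].
  rewrite IH. unfold next_beta, next_weight, weight, beta.
  rewrite (pnorm_iter_succ a b F n beta0 HF).
  change (Nat.iter (Datatypes.S n) F beta0) with (F (Nat.iter n F beta0)).
  rewrite (ind_lift a b F _ _ HF).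
  destruct (ind_spec (Nat.iter n F beta0) t) as [[m [E ->]] | [_ ->]]; [| ring].
  rewrite E, rho_shift_Z. ring.
Qed.

(** A shift of the index changes the sum only at its two ends; these ends will be the two jumps of
    [slope]. *)
Lemma jump_sum_telescope n t :
  jump_sum next_beta next_weight n t =
  jump_sum beta weight n t - c * ind beta0 t + weight n * ind (beta n) t.
Proof.
  induction n as [| n IH]; cbn [jump_sum].
  - unfold weight, beta; simpl. rewrite pnorm_e. ring.
  - rewrite IH. unfold next_beta, next_weight. ring.
Qed.

End Orbit.

Lemma linearizing_development a b F s n :
  lift a b F -> s = 1 \/ s = -1 -> Nat.iter n (T a b) (0, s) = (0, - s) ->
  exists (H : R -> mat) (K : R -> R) (L M : mat),
    (forall t, mdet (H t) = 1) /\ has_jumps H K /\ mdet L = 1 /\ mdet M = 1 /\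
    mmul L M = mmul M L /\
    (forall t, H (t + 1) = mmul M (H t)) /\
    (forall t, mmul (H (F t)) (slope a b t) = mmul L (H t)).
Proof.
  intros HF Hs Hn.
  (* [s / 4] is the angle of [(0, s)] in turns, and [c] is the opposite of the jump of [slope] at
     that pole. The jumps of [H] are placed at the iterates [1] to [n] of this angle. *)
  set (beta0 := s / 4). set (c := s * (a - b)).
  assert (E0 : e beta0 = (0, s)).
  { unfold beta0. destruct Hs; subst s; [rewrite <- e_quarter | rewrite <- e_minus_quarter]; f_equal; field. }
  assert (E1 : e (- beta0) = (0, - s)).
  { unfold beta0. destruct Hs; subst s.
    - replace (Ropp 1) with (-1) by ring. rewrite <- e_minus_quarter; f_equal; field.
    - replace (- -1) with 1 by ring. rewrite <- e_quarter; f_equal; field. }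
  pose proof (iter_T_e a b F n beta0 HF) as En.
  rewrite E0, Hn, <- E1, pnorm_e, scal_1 in En.
  destruct (e_inj _ _ En) as [m Em].
  destruct (has_jumps_exists
    (fun j => Nat.iter (Datatypes.S j) F beta0)
    (fun j => c * (pnorm (Nat.iter (Datatypes.S j) (T a b) (e beta0)) *
                   pnorm (Nat.iter (Datatypes.S j) (T a b) (e beta0)))) n) as [H [DH J]].
  destruct (has_jumps_monodromy H _ DH J (jump_sum_shift _ _ n)) as [M [DM HM]].
  destruct (has_jumps_linearizes a b F H _ HF DH J) as [L [DL HL]].
  { intros t. rewrite (jump_sum_lift a b F beta0 c HF n t).
    rewrite (jump_sum_telescope a b F beta0 c n t).
    (* The norm of [T^n (0, s)] is exactly 1, so the last weight is [c], the jump of [slope] at the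
       other pole. *)
    rewrite E0, Hn, <- E1, pnorm_e, Em.
    assert (I : ind (- beta0 + IZR m) t = ind (- beta0) t).
    { destruct (ind_spec (- beta0) t) as [[k [-> ->]] | [N ->]].
      - replace (- beta0 + IZR k) with (- beta0 + IZR m + IZR (k - m)) by (rewrite minus_IZR; ring).
        apply ind_translate.
      - apply ind_other. intros k E. apply (N (m + k)%Z). rewrite plus_IZR. lra. }
    rewrite I.
    assert (SJ : slope_jump a b t = - c * ind beta0 t + c * ind (- beta0) t).
    { unfold slope_jump, c, beta0. destruct Hs; subst s.
      - ring.
      - replace (-1 / 4) with (- (1 / 4)) by field. replace (- - (1 / 4)) with (1 / 4) by field. ring. }
    rewrite SJ. ring. }
  exists H, (jump_sum
    (fun j => Nat.iter (Datatypes.S j) F beta0)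
    (fun j => c * (pnorm (Nat.iter (Datatypes.S j) (T a b) (e beta0)) *
                   pnorm (Nat.iter (Datatypes.S j) (T a b) (e beta0)))) n), L, M.
  repeat (split; [assumption |]). split; [| split; assumption].
  (* Since [F (0 + 1) = F 0 + 1], taking a full turn and then applying [F] gives the same matrix as
     the opposite order. Cancelling the invertible [H 0] leaves the commutation. *)
  assert (E : mmul (mmul L M) (H 0) = mmul (mmul M L) (H 0)).
  { rewrite <- !mmul_assoc, <- HM, <- HL, <- HL, mmul_assoc, <- HM.
    destruct HF as [_ [HF1 _]]. rewrite HF1, slope_shift. reflexivity. }
  rewrite <- (mmul_1_r (mmul L M)), <- (mmul_1_r (mmul M L)).
  rewrite <- (mmul_madj_r (H 0) (DH 0)), !(mmul_assoc _ (H 0)), E. reflexivity.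
Qed.

(** * The invariant quadratic form *)

(** The image of [e t] under the piecewise linear map with derivative [H]: by homogeneity, the
    derivative applied to the vector itself. *)
Definition developed (H : R -> mat) (t : R) : pt := mapp (H t) (e t).

Lemma continuity_glue (f g1 g2 : R -> R) t d :
  continuity g1 -> continuity g2 -> 0 < d -> g1 t = f t -> g2 t = f t ->
  (forall s, t - d < s < t + d -> f s = g1 s \/ f s = g2 s) -> continuity_pt f t.
Proof.
  intros C1 C2 Hd E1 E2 Hf eps Heps.
  destruct (continuity_near g1 t eps C1 Heps) as [d1 [Hd1 H1]].
  destruct (continuity_near g2 t eps C2 Heps) as [d2 [Hd2 H2]].
  set (m := Rmin d (Rmin d1 d2)).
  assert (M1 : m <= d) by apply Rmin_l.
  assert (M2 : m <= d1) by (eapply Rle_trans; [apply Rmin_r | apply Rmin_l]).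
  assert (M3 : m <= d2) by (eapply Rle_trans; [apply Rmin_r | apply Rmin_r]).
  exists m. split; [repeat apply Rmin_pos; assumption |].
  intros s [_ Hs]. simpl in *. unfold Rdist in *. apply Rabs_def2 in Hs.
  destruct (Hf s) as [-> | ->]; [lra | |].
  - rewrite <- E1. apply H1; lra.
  - rewrite <- E2. apply H2; lra.
Qed.

Lemma continuity_linear (x y : R) : continuity (fun t => x * fst (e t) + y * snd (e t)).
Proof.
  apply (continuity_plus (fun t => x * fst (e t)) (fun t => y * snd (e t))).
  - apply (continuity_scal (fun t => fst (e t))), continuity_fst_e.
  - apply (continuity_scal (fun t => snd (e t))), continuity_snd_e.
Qed.

Lemma has_jumps_left H K t d :
  (forall s, t - d < s < t -> H t = mmul (H s) (shear (e t) (K t))) ->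
  forall s, t - d < s < t -> H s = mmul (H t) (shear (e t) (- K t)).
Proof.
  intros Hl s Hs. rewrite (Hl s Hs), <- mmul_assoc, shear_add.
  replace (K t + - K t) with 0 by ring. rewrite shear_0, mmul_1_r. reflexivity.
Qed.

Lemma pcont_developed H K : has_jumps H K -> pcont (developed H).
Proof.
  intros J.
  split; intros t; destruct (J t) as [d [Hd [Hr Hl]]];
    set (N := mmul (H t) (shear (e t) (- K t)));
    assert (EN : mapp N (e t) = mapp (H t) (e t)) by (unfold N; rewrite mapp_mmul, shear_self; reflexivity).
  - apply (continuity_glue _ (fun s => fst (mapp (H t) (e s))) (fun s => fst (mapp N (e s))) t d).
    + apply continuity_linear.
    + apply continuity_linear.
    + assumption.
    + reflexivity.
    + rewrite EN. reflexivity.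
    + intros s Hs. unfold developed. destruct (Rle_lt_dec t s).
      * left. rewrite (Hr s) by lra. reflexivity.
      * right. rewrite (has_jumps_left H K t d Hl s) by lra. reflexivity.
  - apply (continuity_glue _ (fun s => snd (mapp (H t) (e s))) (fun s => snd (mapp N (e s))) t d).
    + apply continuity_linear.
    + apply continuity_linear.
    + assumption.
    + reflexivity.
    + rewrite EN. reflexivity.
    + intros s Hs. unfold developed. destruct (Rle_lt_dec t s).
      * left. rewrite (Hr s) by lra. reflexivity.
      * right. rewrite (has_jumps_left H K t d Hl s) by lra. reflexivity.
Qed.

(** Distinct angles in a half-open half turn are never proportional, so [quad_three_zeros] leaves at
    most two zeros. *)
Lemma quad_zeros_half_turn k x :
  fnonzero k ->
  exists l, forall s, x <= s < x + 1 / 2 -> quad k (e s) = 0 -> In s l.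
Proof.
  intros N.
  pose (Z := fun s => x <= s < x + 1 / 2 /\ quad k (e s) = 0).
  assert (C : forall s t, Z s -> Z t -> s <> t -> cross (e s) (e t) <> 0).
  { intros s t [Hs _] [Ht _] Nst. destruct (Rtotal_order s t) as [h | [h | h]].
    - pose proof (cross_e_pos s t). lra.
    - contradiction.
    - rewrite cross_anti. pose proof (cross_e_pos t s). lra. }
  destruct (classic (exists s, Z s)) as [[s Zs] | N1].
  2: { exists nil. intros s Hs Q. exfalso; apply N1; exists s; split; assumption. }
  destruct (classic (exists t, Z t /\ t <> s)) as [[t [Zt Nt]] | N2].
  2: { exists (s :: nil). intros t Ht Q. left. apply NNPP; intros Nt.
       apply N2; exists t. repeat split; try apply Ht; auto. }
  exists (s :: t :: nil). intros u Hu Q. simpl.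
  apply NNPP; intros Nu.
  assert (Zu : Z u) by (split; assumption).
  apply (quad_three_zeros k (e s) (e t) (e u)); try assumption.
  - apply C; auto.
  - apply C; auto.
  - apply C; auto.
  - apply Zs.
  - apply Zt.
Qed.

(** On each side of an angle [developed] is one matrix applied to [e], so the zeros there are those
    of a nonzero pulled-back form. Chaining concatenates the finite lists. *)
Lemma developed_zeros_finite H K k :
  (forall t, mdet (H t) = 1) -> has_jumps H K -> fnonzero k ->
  forall x y, x <= y ->
  exists l, forall t, x <= t <= y -> quad k (developed H t) = 0 -> In t l.
Proof.
  intros DH J N. apply interval_chaining.
  - intros x y z Hxy Hyz [l1 H1] [l2 H2]. exists (l1 ++ l2). intros t Ht Q.
    apply in_or_app. destruct (Rle_dec t y).
    + left; apply H1; [lra | assumption].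
    + right; apply H2; [lra | assumption].
  - intros t. destruct (J t) as [d [Hd [Hr Hl]]].
    pose proof (Rmin_l d (1 / 2)) as M1. pose proof (Rmin_r d (1 / 2)) as M2.
    exists (Rmin d (1 / 2)). split; [apply Rmin_pos; lra |].
    intros x y Hx Hy.
    destruct (quad_zeros_half_turn (pullback k (H t)) t) as [l1 H1].
    { apply pullback_nonzero; auto. }
    destruct (quad_zeros_half_turn (pullback k (mmul (H t) (shear (e t) (- K t)))) x) as [l2 H2].
    { apply pullback_nonzero; [rewrite mdet_mmul, DH, mdet_shear; ring | assumption]. }
    exists (l1 ++ l2). intros s Hs Q. apply in_or_app. unfold developed in Q.
    destruct (Rle_dec t s).
    + left. apply H1; [lra |]. rewrite quad_pullback, <- (Hr s) by lra. assumption.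
    + right. apply H2; [lra |].
      rewrite quad_pullback, <- (has_jumps_left H K t d Hl s) by lra. assumption.
Qed.

Lemma nonvanishing_sign (f : R -> R) :
  continuity f -> (forall t, f t <> 0) -> (forall t, 0 < f t) \/ (forall t, f t < 0).
Proof.
  intros Hf N.
  assert (P : forall s t, 0 < f s -> f t < 0 -> False).
  { intros s t Hs Ht. destruct (Rle_lt_dec t s).
    - destruct (IVT_value f t s 0 Hf) as [z [_ Hz]]; [assumption | lra |]. exact (N z Hz).
    - destruct (IVT_value (fun u => - f u) s t 0) as [z [_ Hz]].
      + apply continuity_opp; assumption.
      + lra.
      + lra.
      + apply (N z); lra. }
  destruct (Rtotal_order (f 0) 0) as [h | [h | h]].
  - right. intros t. destruct (Rtotal_order (f t) 0) as [h' | [h' | h']]; try assumption.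
    + exfalso; exact (N t h').
    + exfalso; exact (P t 0 h' h).
  - exfalso; exact (N 0 h).
  - left. intros t. destruct (Rtotal_order (f t) 0) as [h' | [h' | h']]; try assumption.
    + exfalso; exact (P 0 t h h').
    + exfalso; exact (N t h').
Qed.

Lemma continuity_quad k (g : R -> pt) : pcont g -> continuity (fun t => quad k (g t)).
Proof.
  intros [C1 C2]. unfold quad.
  apply (continuity_plus (fun t => fA k * fst (g t) * fst (g t) + fB k * fst (g t) * snd (g t))
                         (fun t => fC k * snd (g t) * snd (g t))).
  - apply (continuity_plus (fun t => fA k * fst (g t) * fst (g t)) (fun t => fB k * fst (g t) * snd (g t))).
    + apply (continuity_mult (fun t => fA k * fst (g t)) (fun t => fst (g t))); [| assumption].
      apply (continuity_scal (fun t => fst (g t))); assumption.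
    + apply (continuity_mult (fun t => fB k * fst (g t)) (fun t => snd (g t))); [| assumption].
      apply (continuity_scal (fun t => fst (g t))); assumption.
  - apply (continuity_mult (fun t => fC k * snd (g t)) (fun t => snd (g t))); [| assumption].
    apply (continuity_scal (fun t => snd (g t))); assumption.
Qed.

Definition aperiodic (F : R -> R) : Prop :=
  forall n (m : Z) t, (0 < n)%nat -> Nat.iter n F t <> t + IZR m.

(** Dividing [developed H] by [sqrt (quad k)] unrolls the circle along the
    conic [quad k = 1], where [F] and the full turn act by linear maps. *)
Record uniformization (a b : R) (F : R -> R) (H : R -> mat) (k : form) : Prop := {
  unif_det : forall t, mdet (H t) = 1;
  unif_jumps : exists K, has_jumps H K;
  unif_nonzero : fnonzero k;
  unif_pos : forall t, 0 < quad k (developed H t);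
  unif_turn : exists M, mdet M = 1 /\ (forall p, quad k (mapp M p) = quad k p) /\
                forall t, developed H (t + 1) = mapp M (developed H t);
  unif_lift : exists L, mdet L = 1 /\ (forall p, quad k (mapp L p) = quad k p) /\
                forall t, scal (rho a b t) (developed H (F t)) = mapp L (developed H t) }.

Lemma uniformization_exists a b F s n :
  lift a b F -> aperiodic F -> s = 1 \/ s = -1 -> Nat.iter n (T a b) (0, s) = (0, - s) ->
  exists H k, uniformization a b F H k.
Proof.
  intros HF Ap Hs Hn.
  destruct (linearizing_development a b F s n HF Hs Hn)
    as [H [K [L [M [DH [J [DL [DM [C [HM HL]]]]]]]]]].
  destruct (common_invariant_form L M DL DM C) as [k [Nk [KL KM]]].
  assert (UM : forall t, developed H (t + 1) = mapp M (developed H t)).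
  { intros t. unfold developed. rewrite HM, e_shift, mapp_mmul. reflexivity. }
  assert (UL : forall t, scal (rho a b t) (developed H (F t)) = mapp L (developed H t)).
  { intros t. unfold developed. rewrite <- mapp_scal, <- (T_e a b F t HF), <- mapp_slope.
    rewrite <- !mapp_mmul, HL. reflexivity. }
  assert (NZ : forall t, quad k (developed H t) <> 0).
  { intros t0 Z0.
    assert (ZF : forall n, quad k (developed H (Nat.iter n F t0)) = 0).
    { induction n0 as [| n0 IH]; [assumption |]. simpl.
      set (t := Nat.iter n0 F t0) in *. pose proof (rho_pos a b t) as Pr.
      rewrite <- KL, <- UL, quad_scal in IH. apply Rmult_integral in IH.
      destruct IH as [IH | IH]; [exfalso; nra | assumption]. }
    assert (ZZ : forall t, quad k (developed H (t + 1)) = quad k (developed H t))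
      by (intros t; rewrite UM, KM; reflexivity).
    destruct (developed_zeros_finite H K k DH J Nk 0 1) as [l Hl]; [lra |].
    pose (x := fun n => Nat.iter n F t0).
    destruct (pigeonhole R (fun n => x n + IZR (- Int_part (x n))) l) as [i [j [Hij E]]].
    { intros i. apply Hl.
      - rewrite opp_IZR. destruct (base_Int_part (x i)). lra.
      - rewrite (shift_Z R (fun t => quad k (developed H t)) ZZ). apply ZF. }
    apply (Ap (j - i)%nat (Int_part (x j) - Int_part (x i))%Z (x i)); [lia |].
    unfold x at 1. rewrite <- Nat.iter_add. replace (j - i + i)%nat with j by lia.
    fold (x j). rewrite minus_IZR. rewrite !opp_IZR in E. lra. }
  destruct (nonvanishing_sign (fun t => quad k (developed H t))) as [P | P].
  - apply continuity_quad. apply (pcont_developed H K J).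
  - exact NZ.
  - exists H, k. constructor; eauto.
  - exists H, (fopp k). constructor.
    + assumption.
    + eauto.
    + apply fopp_nonzero; assumption.
    + intros t. rewrite quad_fopp. specialize (P t). lra.
    + exists M. repeat split; auto. intros p. rewrite !quad_fopp, KM. reflexivity.
    + exists L. repeat split; auto. intros p. rewrite !quad_fopp, KL. reflexivity.
Qed.

(** * Density of orbits *)

(** Polar radius, at angle [t], of the level curve on which the pulled-back form equals 1. *)
Definition radius (H : R -> mat) (k : form) (t : R) : R := / sqrt (quad k (developed H t)).

Definition unit_developed (H : R -> mat) (k : form) (t : R) : pt :=
  scal (radius H k t) (developed H t).

Lemma radius_pos a b F H k t : uniformization a b F H k -> 0 < radius H k t.
Proof. intros U. apply Rinv_0_lt_compat, sqrt_lt_R0, (unif_pos _ _ _ _ _ U). Qed.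

Lemma radius_sqr a b F H k t :
  uniformization a b F H k -> radius H k t * radius H k t * quad k (developed H t) = 1.
Proof.
  intros U. pose proof (unif_pos _ _ _ _ _ U t) as P. unfold radius.
  pose proof (sqrt_lt_R0 _ P) as Ps. pose proof (sqrt_sqrt _ (Rlt_le _ _ P)) as E.
  rewrite <- E at 3. field. lra.
Qed.

Lemma radius_shift a b F H k t : uniformization a b F H k -> radius H k (t + 1) = radius H k t.
Proof.
  intros U. destruct (unif_turn _ _ _ _ _ U) as [M [_ [KM UM]]].
  unfold radius. rewrite UM, KM. reflexivity.
Qed.

(** Polar form of the invariance: [T] sends the point of the level curve at angle [t] to the one at
    angle [F t]. *)
Lemma radius_lift a b F H k t :
  uniformization a b F H k -> radius H k (F t) = rho a b t * radius H k t.
Proof.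
  intros U. destruct (unif_lift _ _ _ _ _ U) as [L [_ [KL UL]]].
  pose proof (rho_pos a b t) as Pr. pose proof (unif_pos _ _ _ _ _ U (F t)) as P.
  unfold radius. rewrite <- (KL (developed H t)), <- UL, quad_scal.
  rewrite sqrt_mult_alt, sqrt_square by nra.
  pose proof (sqrt_lt_R0 _ P). field. lra.
Qed.

Lemma continuity_radius a b F H k : uniformization a b F H k -> continuity (radius H k).
Proof.
  intros U t. destruct (unif_jumps _ _ _ _ _ U) as [K J].
  pose proof (unif_pos _ _ _ _ _ U t) as P.
  apply (continuity_pt_inv (fun t => sqrt (quad k (developed H t)))).
  - apply (continuity_pt_comp (fun t => quad k (developed H t)) sqrt).
    + apply continuity_quad, (pcont_developed H K J).
    + apply continuity_pt_sqrt. lra.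
  - pose proof (sqrt_lt_R0 _ P). lra.
Qed.

Lemma pcont_scal f g : continuity f -> pcont g -> pcont (fun t => scal (f t) (g t)).
Proof.
  intros Cf [C1 C2]. split.
  - apply (continuity_mult f (fun t => fst (g t))); assumption.
  - apply (continuity_mult f (fun t => snd (g t))); assumption.
Qed.

Lemma pcont_unit_developed a b F H k : uniformization a b F H k -> pcont (unit_developed H k).
Proof.
  intros U. destruct (unif_jumps _ _ _ _ _ U) as [K J].
  apply pcont_scal; [apply (continuity_radius _ _ _ _ _ U) | apply (pcont_developed H K J)].
Qed.

Definition chord (H : R -> mat) (k : form) (s t : R) : R :=
  cross (unit_developed H k s) (unit_developed H k t).

Lemma chord_shift a b F H k s t :
  uniformization a b F H k -> chord H k (s + 1) (t + 1) = chord H k s t.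
Proof.
  intros U. destruct (unif_turn _ _ _ _ _ U) as [M [DM [_ UM]]].
  unfold chord, unit_developed. rewrite !(radius_shift a b F H k _ U), !UM, <- !mapp_scal.
  rewrite cross_mapp, DM. ring.
Qed.

Lemma chord_lift a b F H k s t :
  uniformization a b F H k -> chord H k (F s) (F t) = chord H k s t.
Proof.
  intros U. destruct (unif_lift _ _ _ _ _ U) as [L [DL [_ UL]]].
  assert (E : forall u, unit_developed H k (F u) = mapp L (unit_developed H k u)).
  { intros u. unfold unit_developed. rewrite (radius_lift a b F H k u U).
    rewrite Rmult_comm, <- scal_scal, UL, mapp_scal. reflexivity. }
  unfold chord. rewrite !E, cross_mapp, DL. ring.
Qed.

Lemma chord_iter_lift a b F H k n s t :
  uniformization a b F H k -> chord H k (Nat.iter n F s) (Nat.iter n F t) = chord H k s t.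
Proof.
  intros U. induction n as [| n IH]; simpl; [reflexivity |].
  rewrite (chord_lift a b F H k _ _ U). exact IH.
Qed.

(** Just to the right of [s] the matrix [H] is constant, so the chord is a positive multiple of
    [cross (e s) (e t)]. *)
Lemma chord_near_nonzero a b F H k s :
  uniformization a b F H k ->
  exists d, 0 < d /\ forall t, s < t < s + d -> chord H k s t <> 0.
Proof.
  intros U. destruct (unif_jumps _ _ _ _ _ U) as [K J].
  destruct (J s) as [d [Hd [Hr _]]].
  pose proof (Rmin_l d (1 / 2)). pose proof (Rmin_r d (1 / 2)).
  exists (Rmin d (1 / 2)). split; [apply Rmin_pos; lra |]. intros t Ht.
  unfold chord, unit_developed, developed. rewrite (Hr t) by lra.
  rewrite <- !mapp_scal, cross_mapp, (unif_det _ _ _ _ _ U).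
  replace (cross (scal (radius H k s) (e s)) (scal (radius H k t) (e t)))
    with (radius H k s * radius H k t * cross (e s) (e t)) by (unfold cross, scal; simpl; ring).
  pose proof (radius_pos a b F H k s U). pose proof (radius_pos a b F H k t U).
  pose proof (cross_e_pos s t ltac:(lra)).
  apply Rgt_not_eq. repeat apply Rmult_lt_0_compat; lra.
Qed.

Lemma chord_small a b F H k eps :
  uniformization a b F H k -> 0 < eps ->
  exists eta, 0 < eta /\ forall s t, Rabs (t - s) < eta -> Rabs (chord H k s t) < eps.
Proof.
  intros U Heps.
  assert (L : forall x y, x <= y -> exists eta, 0 < eta /\
     forall s t, x <= s <= y -> Rabs (t - s) < eta -> Rabs (chord H k s t) < eps).
  { apply interval_chaining.
    - intros x y z Hxy Hyz [d1 [Hd1 H1]] [d2 [Hd2 H2]].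
      pose proof (Rmin_l d1 d2). pose proof (Rmin_r d1 d2).
      exists (Rmin d1 d2). split; [apply Rmin_pos; assumption |].
      intros s t Hs Ht. destruct (Rle_dec s y); [apply H1 | apply H2]; lra.
    - intros t0. destruct (pcont_unit_developed a b F H k U) as [C1 C2].
      set (v := unit_developed H k) in *.
      set (B := Rabs (fst (v t0)) + Rabs (snd (v t0))).
      assert (HB : 0 <= B) by (pose proof (Rabs_pos (fst (v t0))); pose proof (Rabs_pos (snd (v t0))); unfold B; lra).
      (* Expanding both vectors around [v t0] gives four terms linear in the deviations, at most
         [2 * B * e'] together, and two quadratic ones, at most [e'] each because [e' <= 1]. The [3]
         instead of [2] makes the final bound strict. *)
      set (e' := Rmin 1 (eps / (2 * B + 3))).
      assert (He0 : 0 < eps / (2 * B + 3)) by (apply Rdiv_lt_0_compat; lra).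
      assert (He' : 0 < e') by (apply Rmin_pos; lra).
      assert (He1 : e' <= 1) by apply Rmin_l.
      assert (He2 : e' * (2 * B + 3) <= eps).
      { apply Rle_trans with (eps / (2 * B + 3) * (2 * B + 3)).
        - apply Rmult_le_compat_r; [lra | apply Rmin_r].
        - right; field; lra. }
      destruct (continuity_near _ t0 e' C1 He') as [d1 [Hd1 H1]].
      destruct (continuity_near _ t0 e' C2 He') as [d2 [Hd2 H2]].
      set (d := Rmin d1 d2).
      assert (D1 : d <= d1) by apply Rmin_l. assert (D2 : d <= d2) by apply Rmin_r.
      assert (Hd : 0 < d) by (apply Rmin_pos; assumption).
      exists (d / 2). split; [lra |]. intros x y Hx Hy. exists (d / 2). split; [lra |].
      intros s t Hs Ht. apply Rabs_def2 in Ht.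
      specialize (H1 s ltac:(lra)) as A1. specialize (H2 s ltac:(lra)) as A2.
      specialize (H1 t ltac:(lra)) as B1. specialize (H2 t ltac:(lra)) as B2.
      unfold chord, cross. fold v.
      set (x0 := fst (v t0)) in *. set (y0 := snd (v t0)) in *.
      set (p1 := fst (v s)) in *. set (p2 := snd (v s)) in *.
      set (q1 := fst (v t)) in *. set (q2 := snd (v t)) in *.
      replace (p1 * q2 - p2 * q1) with
        (x0 * (q2 - y0) + - (x0 * (p2 - y0)) + y0 * (p1 - x0) + - (y0 * (q1 - x0))
         + (p1 - x0) * (q2 - y0) + - ((p2 - y0) * (q1 - x0))) by ring.
      pose proof (Rabs_pos x0) as X0. pose proof (Rabs_pos y0) as Y0.
      assert (P : forall u w, Rabs w < e' -> Rabs (u * w) <= Rabs u * e').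
      { intros u w Hw. rewrite Rabs_mult. apply Rmult_le_compat_l; [apply Rabs_pos | lra]. }
      assert (P' : forall u w, Rabs u < e' -> Rabs w < e' -> Rabs (u * w) <= e').
      { intros u w Hu Hw. pose proof (Rabs_pos u). pose proof (P u w Hw). nra. }
      pose proof (P x0 _ B2) as T1. pose proof (P x0 _ A2) as T2.
      pose proof (P y0 _ A1) as T3. pose proof (P y0 _ B1) as T4.
      pose proof (P' _ _ A1 B2) as T5. pose proof (P' _ _ A2 B1) as T6.
      unfold B in He2.
      set (z1 := x0 * (q2 - y0)) in *. set (z2 := x0 * (p2 - y0)) in *.
      set (z3 := y0 * (p1 - x0)) in *. set (z4 := y0 * (q1 - x0)) in *.
      set (z5 := (p1 - x0) * (q2 - y0)) in *. set (z6 := (p2 - y0) * (q1 - x0)) in *.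
      assert (G : Rabs (z1 + - z2 + z3 + - z4 + z5 + - z6) <=
        Rabs z1 + Rabs z2 + Rabs z3 + Rabs z4 + Rabs z5 + Rabs z6).
      { rewrite <- (Rabs_Ropp z2), <- (Rabs_Ropp z4), <- (Rabs_Ropp z6).
        repeat (eapply Rle_trans; [apply Rabs_triang |]; apply Rplus_le_compat_r).
        apply Rle_refl. }
      lra. }
  destruct (L 0 1) as [eta [Heta Hs]]; [lra |]. exists eta. split; [assumption |].
  intros s t Hst.
  assert (Sh : chord H k (s + IZR (- Int_part s)) (t + IZR (- Int_part s)) = chord H k s t).
  { pose proof (shift_Z R (fun u => chord H k (s + u) (t + u))) as Z. cbv beta in Z.
    specialize (Z ltac:(intros u; rewrite <- !Rplus_assoc; apply (chord_shift a b F H k _ _ U)) (- Int_part s)%Z 0).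
    rewrite !Rplus_0_l, !Rplus_0_r in Z. exact Z. }
  rewrite <- Sh. apply Hs.
  - rewrite opp_IZR. destruct (base_Int_part s). lra.
  - replace (t + IZR (- Int_part s) - (s + IZR (- Int_part s))) with (t - s) by ring. assumption.
Qed.

(** The two-sided orbit modulo 1; backward iterates are expressed through forward ones, as in
    [orbit]. *)
Definition on_orbit (F : R -> R) (t0 u : R) : Prop :=
  exists (n : nat) (m : Z), u = Nat.iter n F t0 + IZR m \/ Nat.iter n F u = t0 + IZR m.

Lemma on_orbit_shift a b F t0 u (m : Z) :
  lift a b F -> on_orbit F t0 u -> on_orbit F t0 (u + IZR m).
Proof.
  intros HF [n [k [E | E]]]; exists n, (k + m)%Z.
  - left. rewrite E, plus_IZR. ring.
  - right. rewrite (iter_lift_shift_Z a b F n m u HF), E, plus_IZR. ring.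
Qed.

Lemma on_orbit_lift a b F t0 u : lift a b F -> on_orbit F t0 u -> on_orbit F t0 (F u).
Proof.
  intros HF [n [m [E | E]]].
  - exists (Datatypes.S n), m. left. rewrite E, (lift_shift_Z a b F m _ HF). reflexivity.
  - destruct n as [| n].
    + exists 1%nat, m. left. simpl in E. subst u. rewrite (lift_shift_Z a b F m _ HF). reflexivity.
    + exists n, m. right. rewrite <- Nat.iter_succ_r. exact E.
Qed.

Lemma on_orbit_lift_inv a b F t0 u : lift a b F -> on_orbit F t0 (F u) -> on_orbit F t0 u.
Proof.
  intros HF [n [m [E | E]]].
  - destruct n as [| n].
    + exists 1%nat, m. right. exact E.
    + exists n, m. left. apply (lift_inj a b F _ _ HF).
      rewrite (lift_shift_Z a b F m _ HF). exact E.
  - exists (Datatypes.S n), m. right. rewrite Nat.iter_succ_r. exact E.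
Qed.

(* A gap of the orbit has infinitely many disjoint images modulo 1, hence
   arbitrarily short ones; but the chord across the gap is invariant. *)
Lemma orbit_dense a b F H k t0 x eta :
  lift a b F -> aperiodic F -> uniformization a b F H k -> 0 < eta ->
  exists u, on_orbit F t0 u /\ Rabs (u - x) < eta.
Proof.
  intros HF Ap U Heta. apply NNPP; intros N.
  assert (Nx : forall u, on_orbit F t0 u -> x - eta < u < x + eta -> False).
  { intros u Hu Hx. apply N; exists u. split; [assumption | apply Rabs_def1; lra]. }
  destruct (completeness (fun u => on_orbit F t0 u /\ u <= x)) as [g [Hg1 Hg2]].
  { exists x. intros u [_ Hu]. assumption. }
  { destruct (floor_exists (x - t0)) as [m Hm]. exists (t0 + IZR m). split; [| lra].
    exists 0%nat, m. left. reflexivity. }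
  (* The left end [g] of the gap is on the orbit or a limit of orbit points from the left; in this
     form the property passes to the images of [g]. *)
  assert (Lim0 : forall eps, 0 < eps -> exists u, on_orbit F t0 u /\ g - eps < u <= g).
  { intros eps He. apply NNPP; intros N'.
    assert (g <= g - eps); [| lra]. apply Hg2. intros u [Hu1 Hu2].
    apply Rnot_lt_le; intros L. apply N'. exists u. split; [assumption | split; [assumption |]].
    apply Hg1. split; assumption. }
  assert (Hgx : g <= x) by (apply Hg2; intros u [_ Hu]; assumption).
  assert (Gap0 : forall u, on_orbit F t0 u -> g < u < x + eta -> False).
  { intros u Hu [Hu1 Hu2]. destruct (Rle_lt_dec u x).
    - assert (u <= g) by (apply Hg1; split; assumption). lra.
    - apply (Nx u Hu). lra. }
  destruct (chord_near_nonzero a b F H k g U) as [d [Hd Hc]].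
  (* [y] lies inside the gap and close enough to [g] for a nonzero chord: [[g, y]] is the would-be
     wandering interval. *)
  set (y := g + Rmin d eta / 2).
  assert (Hy : g < y < g + d /\ y < x + eta).
  { pose proof (Rmin_l d eta). pose proof (Rmin_r d eta). pose proof (Rmin_pos d eta Hd Heta).
    unfold y. lra. }
  assert (Hc0 : 0 < Rabs (chord H k g y)) by (apply Rabs_pos_lt, Hc; lra).
  destruct (chord_small a b F H k _ U Hc0) as [eta' [Heta' Hsm]].
  assert (Gap : forall n u, on_orbit F t0 u -> Nat.iter n F g < u < Nat.iter n F y -> False).
  { induction n as [| n IH]; intros u Hu Hlt.
    - apply (Gap0 u Hu). simpl in Hlt. lra.
    - destruct (lift_surj a b F u HF) as [v Ev]. subst u.
      apply (IH v (on_orbit_lift_inv a b F t0 v HF Hu)). simpl in Hlt.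
      split; apply Rnot_le_lt; intros L.
      + destruct L as [L | L]; [apply (lift_incr a b F _ _ HF) in L; lra | subst v; lra].
      + destruct L as [L | L]; [apply (lift_incr a b F _ _ HF) in L; lra | subst v; lra]. }
  assert (Lim : forall n eps, 0 < eps ->
     exists u, on_orbit F t0 u /\ Nat.iter n F g - eps < u <= Nat.iter n F g).
  { induction n as [| n IH]; intros eps He; [apply Lim0; assumption |].
    destruct (continuity_near F (Nat.iter n F g) eps (proj1 HF) He) as [d1 [Hd1 C]].
    destruct (IH d1 Hd1) as [u [Hu1 Hu2]]. exists (F u).
    split; [apply (on_orbit_lift a b F t0 u HF Hu1) |]. simpl.
    specialize (C u ltac:(lra)). apply Rabs_def2 in C.
    split; [lra |]. destruct (proj2 Hu2) as [L | L].
    - apply Rlt_le, (lift_incr a b F _ _ HF L).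
    - rewrite L. apply Rle_refl. }
  (* If the translated image of [g] of order [j] lies beyond the image of [[g, y]] of order [i], the
     latter is shorter than [eta'] and its chord too small. Otherwise it lies beyond the left end of
     that image and before or within its interior, and orbit points close to it on the left fall
     into the image gap. *)
  assert (Key : forall i j (m : Z), 0 < Nat.iter j F g + IZR m - Nat.iter i F g < eta' -> False).
  { intros i j m Hz.
    destruct (Rle_lt_dec (Nat.iter i F y) (Nat.iter j F g + IZR m)) as [L | L].
    - pose proof (iter_lift_incr a b F i g y HF ltac:(lra)) as I.
      specialize (Hsm (Nat.iter i F g) (Nat.iter i F y)).
      rewrite (chord_iter_lift a b F H k i g y U) in Hsm.
      specialize (Hsm ltac:(apply Rabs_def1; lra)). lra.
    - destruct (Lim j (Nat.iter j F g + IZR m - Nat.iter i F g)) as [u [Hu1 Hu2]]; [lra |].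
      apply (Gap i (u + IZR m)); [apply (on_orbit_shift a b F t0 u m HF Hu1) | lra]. }
  destruct (pigeonhole_close (fun n => Nat.iter n F g) eta' Heta') as [i [j [Hij [m Hm]]]].
  apply Rabs_def2 in Hm.
  destruct (Rtotal_order (Nat.iter j F g + IZR m) (Nat.iter i F g)) as [L | [L | L]].
  - apply (Key j i (- m)%Z). rewrite opp_IZR. lra.
  - apply (Ap (j - i)%nat (- m)%Z (Nat.iter i F g)); [lia |].
    rewrite <- Nat.iter_add. replace (j - i + i)%nat with j by lia. rewrite opp_IZR. lra.
  - apply (Key i j m). lra.
Qed.

(** * Invariant circles *)

Definition circle (H : R -> mat) (k : form) (mu t : R) : pt := scal (mu * radius H k t) (e t).

Lemma scal_e_inj l m s t : 0 < l -> 0 < m -> scal l (e s) = scal m (e t) -> e s = e t.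
Proof.
  intros Hl Hm E.
  assert (El : l = m).
  { pose proof (f_equal pnorm E) as P. rewrite !pnorm_scal, !pnorm_e in P by lra. lra. }
  subst m. rewrite <- (scal_1 (e s)), <- (scal_1 (e t)), <- (Rinv_l l) by lra.
  rewrite <- !scal_scal, E. reflexivity.
Qed.

Lemma iter_T_inj a b n p q : Nat.iter n (T a b) p = Nat.iter n (T a b) q -> p = q.
Proof.
  induction n as [| n IH]; simpl; intros E; [assumption |]. apply IH, (T_inj a b _ _ E).
Qed.

Lemma iter_lift_surj a b F n v : lift a b F -> exists z, Nat.iter n F z = v.
Proof.
  intros HF. revert v. induction n as [| n IH]; intros v; [exists v; reflexivity |].
  destruct (lift_surj a b F v HF) as [u <-]. destruct (IH u) as [z <-]. exists z. reflexivity.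
Qed.

Lemma pnorm_le_abs x y : pnorm (x, y) <= Rabs x + Rabs y.
Proof.
  pose proof (Rabs_pos x). pose proof (Rabs_pos y).
  unfold pnorm; simpl. rewrite <- (sqrt_square (Rabs x + Rabs y)) by lra.
  apply sqrt_le_1_alt.
  assert (Rabs x * Rabs x = x * x) by (rewrite <- Rabs_mult; apply Rabs_right; nra).
  assert (Rabs y * Rabs y = y * y) by (rewrite <- Rabs_mult; apply Rabs_right; nra).
  nra.
Qed.

Lemma closed_curve_reduce (g : R -> pt) u :
  (forall t, g (t + 1) = g t) -> exists t, 0 <= t < 1 /\ g u = g t.
Proof.
  intros Hg. exists (u + IZR (- Int_part u)). split.
  - rewrite opp_IZR. destruct (base_Int_part u). lra.
  - symmetry. apply (shift_Z pt g Hg).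
Qed.

(** The squared distance [f] from [p] to the curve attains its minimum on [[0, 1]]; a positive
    minimum would be a forbidden [eps], up to a square root. *)
Lemma closed_curve_closed (g : R -> pt) (A : pt -> Prop) p :
  pcont g -> (forall t, g (t + 1) = g t) -> (forall q, A q -> exists u, q = g u) ->
  closure A p -> exists t, 0 <= t <= 1 /\ p = g t.
Proof.
  intros [C1 C2] Hg HA Hp.
  pose (f := fun t => (fst p - fst (g t)) * (fst p - fst (g t)) + (snd p - snd (g t)) * (snd p - snd (g t))).
  assert (Cf : continuity f).
  { assert (D : forall c h, continuity h -> continuity (fun t => (c - h t) * (c - h t))).
    { intros c h Hh.
      assert (D' : continuity (fun t => c - h t))
        by (apply (continuity_minus (fun _ => c) h); [apply continuity_const; intros ? ?; reflexivity | assumption]).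
      apply (continuity_mult (fun t => c - h t) (fun t => c - h t)); assumption. }
    apply (continuity_plus (fun t => (fst p - fst (g t)) * (fst p - fst (g t)))
                           (fun t => (snd p - snd (g t)) * (snd p - snd (g t)))).
    - apply (D (fst p) (fun t => fst (g t)) C1).
    - apply (D (snd p) (fun t => snd (g t)) C2). }
  destruct (continuity_ab_min f 0 1) as [t [Ht1 Ht2]]; [lra | intros c _; apply Cf |].
  exists t. split; [assumption |].
  destruct (Rle_lt_dec (f t) 0) as [L | L].
  - destruct (Rplus_sqr_eq_0 (fst p - fst (g t)) (snd p - snd (g t))) as [E1 E2].
    { apply Rle_antisym; [exact L |]. apply Rplus_le_le_0_compat; apply Rle_0_sqr. }
    apply pt_eq; lra.
  - exfalso. destruct (Hp (sqrt (f t))) as [q [Aq Hq]]; [apply sqrt_lt_R0; assumption |].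
    destruct (HA q Aq) as [u ->]. destruct (closed_curve_reduce g u Hg) as [v [Hv Ev]].
    rewrite Ev in Hq. unfold pnorm in Hq; simpl in Hq. fold (f v) in Hq.
    apply sqrt_lt_0_alt in Hq. specialize (Ht1 v ltac:(lra)). lra.
Qed.

Lemma closure_of_dense (g : R -> pt) (A : pt -> Prop) (D : R -> Prop) t :
  pcont g -> (forall u, D u -> A (g u)) ->
  (forall x eta, 0 < eta -> exists u, D u /\ Rabs (u - x) < eta) -> closure A (g t).
Proof.
  intros [C1 C2] HD Dense eps Heps.
  destruct (continuity_near _ t (eps / 2) C1 ltac:(lra)) as [d1 [Hd1 H1]].
  destruct (continuity_near _ t (eps / 2) C2 ltac:(lra)) as [d2 [Hd2 H2]].
  pose proof (Rmin_l d1 d2). pose proof (Rmin_r d1 d2).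
  destruct (Dense t (Rmin d1 d2)) as [u [Du Hu]]; [apply Rmin_pos; assumption |].
  apply Rabs_def2 in Hu. exists (g u). split; [apply HD; assumption |].
  eapply Rle_lt_trans; [apply pnorm_le_abs |].
  specialize (H1 u ltac:(lra)). specialize (H2 u ltac:(lra)).
  rewrite Rabs_minus_sym in H1. rewrite Rabs_minus_sym in H2. lra.
Qed.

Section Circle.
Context (a b : R) (F : R -> R) (H : R -> mat) (k : form) (mu : R).
Context (HF : lift a b F) (U : uniformization a b F H k) (Hmu : 0 < mu).

Let gamma (t : R) : pt := circle H k mu t.

Lemma circle_scale_pos t : 0 < mu * radius H k t.
Proof. pose proof (radius_pos a b F H k t U). nra. Qed.

Lemma circle_shift t : gamma (t + 1) = gamma t.
Proof. unfold gamma, circle. rewrite (radius_shift a b F H k t U), e_shift. reflexivity. Qed.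

Lemma T_circle t : T a b (gamma t) = gamma (F t).
Proof.
  unfold gamma, circle. rewrite T_scal, (T_e a b F t HF), scal_scal by apply circle_scale_pos.
  rewrite (radius_lift a b F H k t U). f_equal; ring.
Qed.

Lemma iter_T_circle n t : Nat.iter n (T a b) (gamma t) = gamma (Nat.iter n F t).
Proof. induction n as [| n IH]; simpl; [reflexivity |]. rewrite IH. apply T_circle. Qed.

Lemma circle_inj s t : gamma s = gamma t -> e s = e t.
Proof. apply scal_e_inj; apply circle_scale_pos. Qed.

Lemma pcont_circle : pcont gamma.
Proof.
  apply pcont_scal.
  - apply (continuity_scal (radius H k)), (continuity_radius a b F H k U).
  - split; [apply continuity_fst_e | apply continuity_snd_e].
Qed.

Lemma circle_neq_0 t : gamma t <> (0, 0).
Proof.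
  intros E. pose proof (circle_scale_pos t) as P.
  pose proof (f_equal pnorm E) as N. unfold gamma, circle in N.
  rewrite pnorm_scal, pnorm_e in N by lra. unfold pnorm in N; simpl in N.
  replace (0 * 0 + 0 * 0) with 0 in N by ring. rewrite sqrt_0 in N. lra.
Qed.

Lemma orbit_T_circle t0 z :
  orbit (T a b) (gamma t0) z <-> exists u, on_orbit F t0 u /\ z = gamma u.
Proof.
  split.
  - intros [n [-> | E]].
    + exists (Nat.iter n F t0). split; [| apply iter_T_circle].
      exists n, 0%Z. left. ring.
    + destruct (iter_lift_surj a b F n t0 HF) as [v Ev]. exists v. split.
      * exists n, 0%Z. right. rewrite Ev. ring.
      * apply (iter_T_inj a b n). rewrite E, iter_T_circle, Ev. reflexivity.
  - intros [u [[n [m [E | E]]] ->]]; exists n.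
    + left. rewrite iter_T_circle, E. apply (shift_Z pt gamma circle_shift).
    + right. rewrite iter_T_circle, E. apply (shift_Z pt gamma circle_shift).
Qed.

Lemma closure_orbit_circle t0 p :
  aperiodic F ->
  closure (orbit (T a b) (gamma t0)) p <-> exists t, 0 <= t <= 1 /\ p = gamma t.
Proof.
  intros Ap. split.
  - apply closed_curve_closed.
    + apply pcont_circle.
    + apply circle_shift.
    + intros q Hq. apply orbit_T_circle in Hq. destruct Hq as [u [_ E]]. exists u; exact E.
  - intros [t [_ ->]]. apply (closure_of_dense gamma _ (on_orbit F t0)).
    + apply pcont_circle.
    + intros u Hu. apply orbit_T_circle. exists u. split; [assumption | reflexivity].
    + intros x eta Heta. apply (orbit_dense a b F H k t0 x eta HF Ap U Heta).
Qed.

Lemma invariant_circle_circle (C : pt -> Prop) :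
  (forall p, C p <-> exists t, 0 <= t <= 1 /\ p = gamma t) -> invariant_circle a b C.
Proof.
  intros HC.
  assert (HC' : forall u, C (gamma u)).
  { intros u. destruct (closed_curve_reduce gamma u circle_shift) as [t [Ht E]].
    rewrite E. apply HC. exists t. split; [lra | reflexivity]. }
  split; [| split; [| split; [| split]]].
  - exists gamma. split; [apply pcont_circle |]. split; [apply circle_shift |].
    split; [| exact HC]. intros s t Hs Ht E. apply circle_inj, e_inj in E.
    destruct E as [m E].
    assert (M1 : IZR (-1) < IZR m) by lra. assert (M2 : IZR m < IZR 1) by lra.
    apply lt_IZR in M1, M2. replace m with 0%Z in E by lia. lra.
  - intros p Hp. apply HC in Hp. destruct Hp as [t [_ ->]]. apply circle_neq_0.
  - intros u Nu. destruct (polar u Nu) as [t Et]. pose proof (pnorm_pos u Nu) as Pu.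
    pose proof (circle_scale_pos t) as Pt.
    exists (gamma t). split.
    + split; [apply HC' |]. exists (mu * radius H k t / pnorm u).
      split; [apply Rdiv_lt_0_compat; assumption |].
      rewrite Et at 2. rewrite scal_scal. unfold gamma, circle. f_equal. field. lra.
    + intros q [Cq [l [Hl Eq]]]. apply HC in Cq. destruct Cq as [s [_ ->]].
      rewrite Et, scal_scal in Eq.
      assert (Ee : e s = e t).
      { apply (scal_e_inj (mu * radius H k s) (l * pnorm u)); [apply circle_scale_pos | nra | exact Eq]. }
      apply e_inj in Ee. destruct Ee as [m ->].
      symmetry. apply (shift_Z pt gamma circle_shift).
  - intros p Hp. apply HC in Hp. destruct Hp as [t [_ ->]]. rewrite T_circle. apply HC'.
  - intros q Hq. apply HC in Hq. destruct Hq as [t [_ ->]].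
    destruct (lift_surj a b F t HF) as [s <-]. exists (gamma s). split; [apply HC' | apply T_circle].
Qed.

(** Completing the square gives a multiple of a squared linear form; the positive value at [p0]
    makes the multiple positive, hence absorbed by a square root. *)
Lemma square_of_disc_0 p0 :
  fdisc k = 0 -> 0 < quad k p0 ->
  exists x y, forall p, quad k p = (x * fst p + y * snd p) * (x * fst p + y * snd p).
Proof.
  destruct k as [A B C]; unfold fdisc, quad; simpl. intros D P.
  destruct (Req_dec A 0) as [-> | NA].
  - assert (B = 0) by (apply Rsqr_0_uniq; unfold Rsqr; lra). subst B.
    assert (HC : 0 < C) by (pose proof (Rle_0_sqr (snd p0)); unfold Rsqr in *; nra).
    exists 0, (sqrt C). intros p. rewrite <- (sqrt_sqrt C) at 1 by lra. ring.
  - set (q := A * fst p0 * fst p0 + B * fst p0 * snd p0 + C * snd p0 * snd p0) in P.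
    assert (E : 4 * A * q = Rsqr (2 * A * fst p0 + B * snd p0)).
    { replace (4 * A * q) with (Rsqr (2 * A * fst p0 + B * snd p0)
        - (B * B - 4 * A * C) * (snd p0 * snd p0)) by (unfold q, Rsqr; ring).
      rewrite D. ring. }
    pose proof (Rle_0_sqr (2 * A * fst p0 + B * snd p0)) as S0. rewrite <- E in S0.
    assert (HA : 0 < A) by nra.
    pose proof (sqrt_lt_R0 A HA) as Ps. pose proof (sqrt_sqrt A (Rlt_le _ _ HA)) as Es.
    exists (sqrt A), (B / (2 * sqrt A)). intros p.
    assert (EC : C = B / (2 * sqrt A) * (B / (2 * sqrt A))).
    { replace (B / (2 * sqrt A) * (B / (2 * sqrt A))) with (B * B / (4 * (sqrt A * sqrt A))) by (field; lra).
      rewrite Es. replace (B * B) with (4 * A * C) by lra. field. lra. }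
    rewrite EC at 1. rewrite <- Es at 1. field. lra.
Qed.

Definition conic_type_of (q : form) : conic_type :=
  if Rlt_dec (fdisc q) 0 then Ellipse else if Rlt_dec 0 (fdisc q) then Hyperbola else Line.

(* In the parabolic case the circle lies on [l = mu] and [l = - mu] for a linear
   form [l] on the developed plane, and by continuity on only one of them. *)
Lemma sector_conic x y N :
  mdet N = 1 -> x < y -> (forall s, x <= s <= y -> developed H s = mapp N (e s)) ->
  exists q, has_type q (conic_type_of k) /\
    forall s, x <= s <= y -> conic_eval q (gamma s) = 0.
Proof.
  intros DN Hxy HN.
  assert (Hquad : forall s, x <= s <= y -> quad (pullback k N) (gamma s) = mu * mu).
  { intros s Hs. unfold gamma, circle. rewrite quad_scal, quad_pullback, <- HN by assumption.
    pose proof (radius_sqr a b F H k s U).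
    replace (mu * radius H k s * (mu * radius H k s) * quad k (developed H s)) with
      (mu * mu * (radius H k s * radius H k s * quad k (developed H s))) by ring.
    rewrite H0. ring. }
  assert (Hdisc : fdisc (pullback k N) = fdisc k) by (rewrite fdisc_pullback, DN; ring).
  (* Without linear terms the determinant is [mu * mu * fdisc k / 4]. *)
  assert (Hconic : fdisc k <> 0 ->
    conic_det (mkConic (fA (pullback k N)) (fB (pullback k N)) (fC (pullback k N)) 0 0 (- (mu * mu))) <> 0).
  { rewrite <- Hdisc. unfold fdisc, conic_det. set (q := pullback k N). cbn [cA cB cC cD cE cF].
    intros Nd E. apply Nd. apply Rmult_eq_reg_l with (mu * mu); nra. }
  assert (Heval : forall s, x <= s <= y -> conic_eval
     (mkConic (fA (pullback k N)) (fB (pullback k N)) (fC (pullback k N)) 0 0 (- (mu * mu))) (gamma s) = 0).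
  { intros s Hs. specialize (Hquad s Hs). destruct (gamma s) as [u v].
    unfold conic_eval, quad in *. cbn [cA cB cC cD cE cF fst snd] in *. lra. }
  unfold conic_type_of. destruct Rlt_dec as [h | h]; [| destruct Rlt_dec as [h' | h']].
  - eexists. split; [| exact Heval]. split; [| apply Hconic; lra].
    cbn [cA cB cC]. unfold fdisc in *. lra.
  - eexists. split; [| exact Heval]. split; [| apply Hconic; lra].
    cbn [cA cB cC]. unfold fdisc in *. lra.
  - destruct (square_of_disc_0 (developed H x)) as [al [be Hsq]]; [lra | apply (unif_pos _ _ _ _ _ U) |].
    set (l := fun p => al * fst p + be * snd p) in *.
    destruct (unif_jumps _ _ _ _ _ U) as [K J].
    destruct (pcont_developed H K J) as [C1 C2].
    assert (Cl : continuity (fun t => l (developed H t))).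
    { apply (continuity_plus (fun t => al * fst (developed H t)) (fun t => be * snd (developed H t))).
      - apply (continuity_scal (fun t => fst (developed H t))); assumption.
      - apply (continuity_scal (fun t => snd (developed H t))); assumption. }
    assert (Sq : forall z, 0 < z -> z * z = 1 -> z = 1).
    { intros z Hz E. apply Rsqr_inj; unfold Rsqr; lra. }
    assert (Hl : exists sg, sg <> 0 /\ forall t, radius H k t * l (developed H t) = sg).
    { destruct (nonvanishing_sign _ Cl) as [P | P].
      - intros t E. pose proof (unif_pos _ _ _ _ _ U t) as P. rewrite Hsq in P.
        fold (l (developed H t)) in P. rewrite E in P. lra.
      - exists 1. split; [lra |]. intros t. specialize (P t).
        pose proof (radius_pos a b F H k t U). pose proof (radius_sqr a b F H k t U) as E.
        rewrite Hsq in E. fold (l (developed H t)) in E.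
        apply Sq; [apply Rmult_lt_0_compat; assumption | lra].
      - exists (-1). split; [lra |]. intros t. specialize (P t).
        pose proof (radius_pos a b F H k t U). pose proof (radius_sqr a b F H k t U) as E.
        rewrite Hsq in E. fold (l (developed H t)) in E.
        assert (radius H k t * - l (developed H t) = 1); [| lra].
        apply Sq; [apply Rmult_lt_0_compat; lra | lra]. }
    destruct Hl as [sg [Nsg Hsg]].
    exists (mkConic 0 0 0 (al * m11 N + be * m21 N) (al * m12 N + be * m22 N) (- (mu * sg))).
    assert (Hlin : forall s, x <= s <= y ->
      (al * m11 N + be * m21 N) * fst (gamma s) + (al * m12 N + be * m22 N) * snd (gamma s) = mu * sg).
    { intros s Hs. rewrite <- (Hsg s), (HN s Hs). unfold l, gamma, circle, scal, mapp; simpl. ring. }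
    split.
    + simpl. repeat split. apply NNPP; intros Nn.
      apply not_or_and in Nn. destruct Nn as [N1 N2]. apply NNPP in N1, N2.
      specialize (Hlin x ltac:(lra)). rewrite N1, N2 in Hlin.
      assert (mu * sg <> 0) by (apply Rmult_integral_contrapositive_currified; lra). lra.
    + intros s Hs. specialize (Hlin s Hs). destruct (gamma s) as [u v].
      unfold conic_eval. cbn [cA cB cC cD cE cF fst snd] in *. lra.
Qed.

Definition subarc (x y s : R) : pt := gamma (x + s * (y - x)).

Lemma arc_of_subarc x y p :
  x < y -> arc_of (subarc x y) p <-> exists t, x <= t <= y /\ p = gamma t.
Proof.
  intros Hxy. split.
  - intros [s [Hs ->]]. exists (x + s * (y - x)). split; [nra | reflexivity].
  - intros [t [Ht ->]]. exists ((t - x) / (y - x)). split.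
    + assert (E : (t - x) / (y - x) * (y - x) = t - x) by (field; lra).
      split; apply Rmult_le_reg_r with (y - x); lra.
    + unfold subarc. f_equal. field. lra.
Qed.

Lemma conic_arc_subarc x y N :
  mdet N = 1 -> x < y < x + 1 -> (forall s, x <= s <= y -> developed H s = mapp N (e s)) ->
  conic_arc (conic_type_of k) (subarc x y).
Proof.
  intros DN Hxy HN. split; [split |].
  - assert (Ca : continuity (fun s => x + s * (y - x))) by reg.
    destruct pcont_circle as [C1 C2]. split.
    + apply (continuity_comp (fun s => x + s * (y - x)) (fun t => fst (gamma t))); assumption.
    + apply (continuity_comp (fun s => x + s * (y - x)) (fun t => snd (gamma t))); assumption.
  - intros s t Hs Ht E. apply circle_inj, e_inj in E. destruct E as [m E].
    assert (M1 : IZR (-1) < IZR m) by nra. assert (M2 : IZR m < IZR 1) by nra.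
    apply lt_IZR in M1, M2. replace m with 0%Z in E by lia.
    apply Rmult_eq_reg_r with (y - x); lra.
  - destruct (sector_conic x y N DN (proj1 Hxy) HN) as [q [Hq1 Hq2]].
    exists q. split; [assumption |]. intros p Hp.
    apply arc_of_subarc in Hp; [| lra]. destruct Hp as [t [Ht ->]]. apply Hq2; assumption.
Qed.

Definition covered_by_conic_arcs (x y : R) : Prop :=
  exists arcs : list (R -> pt),
    (forall g, In g arcs -> conic_arc (conic_type_of k) g) /\
    forall p, (exists t, x <= t <= y /\ p = gamma t) <-> exists g, In g arcs /\ arc_of g p.

Lemma conic_arcs_cover x y : x < y -> covered_by_conic_arcs x y.
Proof.
  intros Hxy.
  (* Chaining also meets degenerate segments, which carry no injective arc; the premise [x < y] is
     therefore put inside the property. *)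
  refine (interval_chaining (fun x y => x < y -> covered_by_conic_arcs x y) _ _
            x y (Rlt_le _ _ Hxy) Hxy); clear x y Hxy.
  - intros x y z Hxy Hyz P1 P2 Hxz.
    destruct (Req_dec x y) as [-> | N1]; [apply P2; assumption |].
    destruct (Req_dec y z) as [<- | N2]; [apply P1; assumption |].
    destruct (P1 ltac:(lra)) as [l1 [A1 B1]]. destruct (P2 ltac:(lra)) as [l2 [A2 B2]].
    exists (l1 ++ l2). split.
    + intros g Hg. apply in_app_or in Hg. destruct Hg; auto.
    + intros p. split.
      * intros [t [Ht E]]. destruct (Rle_dec t y).
        -- destruct (proj1 (B1 p)) as [g [Hg1 Hg2]]; [exists t; split; [lra | assumption] |].
           exists g. split; [apply in_or_app; left |]; assumption.
        -- destruct (proj1 (B2 p)) as [g [Hg1 Hg2]]; [exists t; split; [lra | assumption] |].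
           exists g. split; [apply in_or_app; right |]; assumption.
      * intros [g [Hg1 Hg2]]. apply in_app_or in Hg1. destruct Hg1 as [Hg1 | Hg1].
        -- destruct (proj2 (B1 p)) as [t [Ht E]]; [exists g; auto |]. exists t. split; [lra | assumption].
        -- destruct (proj2 (B2 p)) as [t [Ht E]]; [exists g; auto |]. exists t. split; [lra | assumption].
  - intros t. destruct (unif_jumps _ _ _ _ _ U) as [K J].
    destruct (J t) as [d [Hd [Hr Hl]]].
    pose proof (Rmin_l d 1) as M1. pose proof (Rmin_r d 1) as M2.
    exists (Rmin d 1). split; [apply Rmin_pos; lra |]. intros x y Hx Hy Hxy.
    pose proof (unif_det _ _ _ _ _ U) as DH.
    (* [N] is the matrix valid just before [t]. It agrees with [H t] on [e t], so the left arc may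
       include its end point. *)
    set (N := mmul (H t) (shear (e t) (- K t))).
    assert (DN : mdet N = 1) by (unfold N; rewrite mdet_mmul, DH, mdet_shear; ring).
    assert (Right : t < y -> conic_arc (conic_type_of k) (subarc t y)).
    { intros h. apply (conic_arc_subarc t y (H t)); [apply DH | lra |].
      intros s Hs. unfold developed. rewrite (Hr s) by lra. reflexivity. }
    assert (Left : x < t -> conic_arc (conic_type_of k) (subarc x t)).
    { intros h. apply (conic_arc_subarc x t N); [assumption | lra |].
      intros s Hs. unfold developed. destruct (proj2 Hs) as [L | ->].
      - rewrite (has_jumps_left H K t d Hl s) by lra. reflexivity.
      - unfold N. rewrite mapp_mmul, shear_self. reflexivity. }
    assert (One : forall u v, u < v -> conic_arc (conic_type_of k) (subarc u v) ->
      covered_by_conic_arcs u v).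
    { intros u v Huv Ha. exists (subarc u v :: nil). split.
      - intros g [<- | []]. assumption.
      - intros p. rewrite <- (arc_of_subarc u v p Huv). split.
        + intros Hp. exists (subarc u v). split; [left; reflexivity | assumption].
        + intros [g [[<- | []] Hp]]. assumption. }
    destruct (proj2 Hx) as [Lx | ->]; [| apply One; [assumption | apply Right; assumption]].
    destruct (proj1 Hy) as [Ly | <-]; [| apply One; [assumption | apply Left; assumption]].
    exists (subarc x t :: subarc t y :: nil). split.
    + intros g [<- | [<- | []]]; auto.
    + intros p. split.
      * intros [s [Hs E]]. destruct (Rle_dec s t).
        -- exists (subarc x t). split; [left; reflexivity |]. apply arc_of_subarc; [assumption |].
           exists s. split; [lra | assumption].
        -- exists (subarc t y). split; [right; left; reflexivity |]. apply arc_of_subarc; [assumption |].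
           exists s. split; [lra | assumption].
      * intros [g [[<- | [<- | []]] Hp]]; apply arc_of_subarc in Hp; try assumption;
          destruct Hp as [s [Hs E]]; exists s; (split; [lra | assumption]).
Qed.

End Circle.

Theorem theorem2p2 (a b : R) :
  (exists rho, rotation_number (S a b) rho /\ irrational rho) ->
  orbit (S a b) (0, 1) (0, -1) ->
  orbit (T a b) (0, 1) (0, -1) /\
  (forall w : pt, w <> (0, 0) ->
     let C := closure (orbit (T a b) w) in
     invariant_circle a b C /\
     exists (ty : conic_type) (arcs : list (R -> pt)),
       (forall g, In g arcs -> conic_arc ty g) /\
       (forall p, C p <-> exists g, In g arcs /\ arc_of g p)).
Proof.
  intros [r [[F [F1 [F2 [F3 Hcv]]]] Hirr]] [n Hn].
  assert (HF : lift a b F) by (repeat split; assumption).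
  assert (Ap : aperiodic F)
    by (intros j m t Hj; apply (lift_aperiodic a b F r j m t HF Hcv Hirr Hj)).
  (* The sign [s] names the pole from which the forward orbit reaches the other, so that both cases
     of [orbit] are treated at once. *)
  assert (Poles : exists s, (s = 1 \/ s = -1) /\ Nat.iter n (T a b) (0, s) = (0, - s)).
  { destruct Hn as [E | E].
    - exists 1. split; [left; reflexivity |]. apply orbit_joins_poles; [left; reflexivity |].
      rewrite <- E. f_equal; ring.
    - exists (-1). split; [right; reflexivity |]. apply orbit_joins_poles; [right; reflexivity |].
      rewrite E. f_equal; ring. }
  destruct Poles as [s [Hs Es]].
  split.
  { exists n. destruct Hs; subst s.
    - left. rewrite Es. f_equal; ring.
    - right. rewrite Es. f_equal; ring. }
  destruct (uniformization_exists a b F s n HF Ap Hs Es) as [H [k U]].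
  intros w Nw C.
  destruct (polar w Nw) as [t0 Et0].
  pose proof (radius_pos a b F H k t0 U) as Pr.
  set (mu := pnorm w / radius H k t0).
  assert (Hmu : 0 < mu) by (apply Rdiv_lt_0_compat; [apply pnorm_pos |]; assumption).
  assert (Ew : w = circle H k mu t0).
  { rewrite Et0 at 1. unfold circle, mu. f_equal. field. lra. }
  assert (HC : forall p, C p <-> exists t, 0 <= t <= 1 /\ p = circle H k mu t).
  { intros p. unfold C. rewrite Ew.
    apply (closure_orbit_circle a b F H k mu HF U Hmu t0 p Ap). }
  split.
  - apply (invariant_circle_circle a b F H k mu HF U Hmu C HC).
  - destruct (conic_arcs_cover a b F H k mu U Hmu 0 1) as [arcs [A1 A2]]; [lra |].
    exists (conic_type_of k), arcs. split; [assumption |].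
    intros p. rewrite HC. apply A2.
Qed.
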